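(* Consider types A1 and A2 in finite dimension (see context), with $V=\mathbb{C}^n$, flag variety $X$ of complete flags of $V$, and groups $K,G^0\subset\mathrm{GL}(V)$. Let $\mathfrak{I}_n^\epsilon=\mathfrak{I}_n$ in type A1 and $\mathfrak{I}_n^\epsilon=\mathfrak{I}'_n$ in type A2. (a) For every $w\in\mathfrak{I}_n^\epsilon$ we have $\mathcal{O}_w\neq\emptyset$, $\mathfrak{O}_w\neq\emptyset$ and $$\mathcal{O}_w\cap\mathfrak{O}_w=\{\mathcal{F}(v_1,\ldots,v_n):(v_1,\ldots,v_n)\text{ is both } w\text{-dual and } w\text{-conjugate}\}\neq\emptyset.$$ (b) For every $w\in\mathfrak{I}_n^\epsilon$, $$\mathcal{O}_w=\{\mathcal{F}\in X:(\mathcal{F}^\perp,\mathcal{F})\in\mathbb{O}_{w_0w}\}\quad\text{and}\quad\mathfrak{O}_w=\{\mathcal{F}\in X:(\gamma(\mathcal{F}),\mathcal{F})\in\mathbb{O}_w\}.$$ (c) The subsets $\mathcal{O}_w$ ($w\in\mathfrak{I}_n^\epsilon$) are exactly the $K$-orbits of $X$. The subsets $\mathfrak{O}_w$ ($w\in\mathfrak{I}_n^\epsilon$) are exactly the $G^0$-orbits of $X$. (d) The map $\mathcal{O}_w\mapsto\mathfrak{O}_w$ is Matsuki duality.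
   Context: Let $V=\langle e_1,\ldots,e_n\rangle_{\mathbb{C}}$ with vectors identified with coordinate columns and $\overline{x}$ the coordinatewise conjugate. Let $\Omega$ be an $n\times n$ block-diagonal matrix whose diagonal blocks are each $\begin{pmatrix}0&1\\1&0\end{pmatrix}$ or $(1)$ in type A1, and are all $\begin{pmatrix}0&1\\-1&0\end{pmatrix}$ in type A2 (so $n$ is even in type A2). Put $\omega(x,y)={}^tx\,\Omega\,y$, $\gamma(x)=\Omega\overline{x}$, $K=\{g\in\mathrm{GL}(V):g\text{ preserves }\omega\}$, $G^0=\{g\in\mathrm{GL}(V):\gamma g=g\gamma\}$. Set $\epsilon=1$ in type A1, $\epsilon=-1$ in type A2. $X$ is the variety of complete flags $\mathcal{F}=(F_0\subset F_1\subset\cdots\subset F_n=V)$, $\dim F_k=k$. For a basis, $\mathcal{F}(v_1,\ldots,v_n)$ is the flag with $F_k=\langle v_1,\ldots,v_k\rangle_{\mathbb{C}}$. For $\mathcal{F}=(F_0,\ldots,F_n)$ put $\mathcal{F}^\perp=(F_n^\perp,\ldots,F_0^\perp)$ (orthogonals for $\omega$) and $\gamma(\mathcal{F})=(\gamma(F_0),\ldots,\gamma(F_n))$. For $w\in\mathfrak{S}_n$ (write $w_k=w(k)$), $\mathbb{O}_w\subset X\times X$ is the set of pairs $(\mathcal{F},\mathcal{F}')$ with $\dim F_k\cap F'_\ell=|\{j\in\{1,\ldots,\ell\}:w_j\in\{1,\ldots,k\}\}|$ for all $k,\ell$; these are the $\mathrm{GL}(V)$-orbits of $X\times X$. $w_0\in\mathfrak{S}_n$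 is $w_0(k)=n-k+1$. $\mathfrak{I}_n\subset\mathfrak{S}_n$ is the set of $w$ with $w^2=\mathrm{id}$; $\mathfrak{I}'_n\subset\mathfrak{I}_n$ is the subset of those without fixed points. For $w\in\mathfrak{I}_n$, a basis $(v_1,\ldots,v_n)$ of $V$ is $w$-dual if for all $k,\ell$: $\omega(v_k,v_\ell)=1$ if $w_k=\ell\ge k$, $=\epsilon$ if $w_k=\ell<k$, $=0$ if $w_k\ne\ell$. It is $w$-conjugate if for all $k$: $\gamma(v_k)=\epsilon v_{w_k}$ if $w_k\ge k$ and $\gamma(v_k)=v_{w_k}$ if $w_k<k$. Put $\mathcal{O}_w=\{\mathcal{F}(v_1,\ldots,v_n):(v_1,\ldots,v_n)\ w\text{-dual}\}$ and $\mathfrak{O}_w=\{\mathcal{F}(v_1,\ldots,v_n):(v_1,\ldots,v_n)\ w\text{-conjugate}\}$. Matsuki duality is the unique bijection $\Xi$ from the set of $K$-orbits of $X$ to the set of $G^0$-orbits of $X$ such that $\mathcal{O}\cap\Xi(\mathcal{O})$ is a single $K\cap G^0$-orbit for every $K$-orbit $\mathcal{O}$. *)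

(* Defs.v *)
From HB Require Import structures.
From mathcomp Require Import all_boot all_order all_algebra all_fingroup.
From mathcomp Require Import boolp classical_sets functions reals.
From mathcomp Require Import complex.

Set Implicit Arguments.
Unset Strict Implicit.
Unset Printing Implicit Defensive.

Import GRing.Theory.

Local Open Scope ring_scope.
Local Open Scope classical_set_scope.

Inductive typeA := TypeA1 | TypeA2.

Section Defs.
Variables (R : realType) (t : typeA).
Local Notation C := R[i].

Definition eps : C := if t is TypeA1 then 1 else -1.

(* The 2 x 2 block with rows (0, 1) and (eps, 0). *)
Definition block2 : 'M[C]_2 :=
  \matrix_(i, j) (if (i < j)%N then 1 else if (j < i)%N then eps else 0).

(* Block-diagonal matrices, built one diagonal block at a time; the blocks
   (1) are available in type A1 only. *)
Inductive standard_form : forall n, 'M[C]_n -> Prop :=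
| standard_form0 : standard_form (0 : 'M_0)
| standard_form2 n (A : 'M_n) :
    standard_form A -> standard_form (block_mx block2 0 0 A : 'M_(2 + n))
| standard_form1 n (A : 'M_n) :
    t = TypeA1 ->
    standard_form A -> standard_form (block_mx 1%:M 0 0 A : 'M_(1 + n)).

Variable n : nat.
Local Notation V := 'cV[C]_n.

(* Chains (F_0, ..., F_n) of subspaces of V; flags are the chains in X. *)
Definition chain := {ffun 'I_n.+1 -> {vspace V}}.

Definition X : set chain :=
  [set F : chain | (forall k : 'I_n.+1, \dim (F k) = k) /\
     (forall k l : 'I_n.+1, (k <= l)%N -> (F k <= F l)%VS)].

Definition flag_of (v : n.-tuple V) : chain :=
  [ffun k : 'I_n.+1 => <<take k v>>%VS].

(* Permutations act on 'I_n, i.e. on {0, ..., n-1}; j <= l and w_j <= k for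
   indices counted from 1 become j < l and w j < k. *)
Definition relpos (w : 'S_n) : set (chain * chain) :=
  [set P | [/\ X P.1, X P.2 & forall k l : 'I_n.+1,
     \dim (P.1 k :&: P.2 l) = #|[pred j : 'I_n | (j < l)%N & (w j < k)%N]|]].

Definition w0 : 'S_n := perm (@rev_ord_inj n).

(* (s * w)%g is w after s in MathComp. *)
Definition w0_after (w : 'S_n) : 'S_n := (w * w0)%g.

Definition involutions : set 'S_n :=
  [set w | (forall k, w (w k) = k) /\
           (t = TypeA2 -> forall k, w k != k)].

Variable Omega : 'M[C]_n.

Definition omega (x y : V) : C := (x^T *m Omega *m y) 0 0.

Definition gamma (x : V) : V := Omega *m map_mx (@conjc R) x.

Definition orthv (U : {vspace V}) : {vspace V} :=
  (\bigcap_(i < \dim U) lker (linfun (fun x => omega x (vbasis U)`_i : C^o)))%VS.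

Definition gammav (U : {vspace V}) : {vspace V} :=
  <<[seq gamma x | x <- vbasis U]>>%VS.

Fact omega_is_linearl y : linear (fun x : V => omega x y : C^o).
Proof.
move=> a u v; rewrite /omega linearP /= mulmxDl mulmxDl -!scalemxAl.
by rewrite !mxE.
Qed.

Fact omega_is_linearr x : linear (fun y : V => omega x y : C^o).
Proof. by move=> a u v; rewrite /omega linearP /= !mxE. Qed.

Lemma memv_orthv (U : {vspace V}) (x : V) :
  reflect (forall y, y \in U -> omega x y = 0) (x \in orthv U).
Proof.
pose fl y : {linear V -> C^o} := HB.pack (fun x : V => omega x y : C^o)
  (GRing.isLinear.Build C V C^o *:%R _ (omega_is_linearl y)).
pose fr x : {linear V -> C^o} := HB.pack (fun y : V => omega x y : C^o)
  (GRing.isLinear.Build C V C^o *:%R _ (omega_is_linearr x)).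
apply: (iffP idP) => [xU y yU|xU].
- rewrite -[LHS]/(fr x y) (coord_vbasis yU) linear_sum.
  apply: big1 => i _; rewrite linearZ.
  have /subv_bigcapP/(_ i isT) := xU.
  rewrite -memvE memv_ker (lfunE (fl _)) => /eqP fx0.
  by rewrite [fr x _]fx0; exact: mulr0.
- rewrite memvE; apply/subv_bigcapP => i _.
  rewrite -memvE memv_ker (lfunE (fl _)); apply/eqP/xU/vbasis_mem.
  by rewrite mem_nth // size_tuple.
Qed.

Lemma memv_gammav (U : {vspace V}) (x : V) :
  (x \in gammav U) <-> exists2 y, y \in U & x = gamma y.
Proof.
have gammaE (I : finType) (a : I -> C) (u : I -> V) :
    gamma (\sum_i a i *: u i) = \sum_i conjc (a i) *: gamma (u i).
  rewrite /gamma raddf_sum mulmx_sumr; apply: eq_bigr => i _.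
  rewrite scalemxAr; congr (_ *m _).
  by apply/matrixP => j l; rewrite !mxE /= rmorphM.
split=> [xU|[y yU ->]].
- have /= -> := coord_span (X := in_tuple [seq gamma x | x <- vbasis U]) xU.
  exists (\sum_i conjc (coord (in_tuple [seq gamma x | x <- vbasis U]) i x) *:
            (vbasis U)`_i).
    apply: memv_suml => i _; apply/memvZ/vbasis_mem/mem_nth.
    by case: i => i /=; rewrite size_map.
  rewrite gammaE; apply: eq_bigr => i _; rewrite conjcK (nth_map 0) //.
  by case: i => i /=; rewrite size_map.
- rewrite (coord_vbasis yU) gammaE; apply: memv_suml => i _.
  by apply/memvZ/memv_span/map_f/mem_nth; rewrite size_tuple.
Qed.

Definition orth_chain (F : chain) : chain := [ffun k => orthv (F (rev_ord k))].

Definition gamma_chain (F : chain) : chain := [ffun k => gammav (F k)].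

Definition w_dual (w : 'S_n) (v : n.-tuple V) : Prop :=
  basis_of fullv v /\
  forall k l : 'I_n, omega (tnth v k) (tnth v l) =
    if w k == l then (if (k <= l)%N then 1 else eps) else 0.

Definition w_conjugate (w : 'S_n) (v : n.-tuple V) : Prop :=
  basis_of fullv v /\
  forall k : 'I_n, gamma (tnth v k) =
    if (k <= w k)%N then eps *: tnth v (w k) else tnth v (w k).

Definition dual_flags (w : 'S_n) : set chain := [set flag_of v | v in w_dual w].

Definition conjugate_flags (w : 'S_n) : set chain :=
  [set flag_of v | v in w_conjugate w].

Definition GL : set 'M[C]_n := [set g | g \in unitmx].

Definition K : set 'M[C]_n :=
  [set g | GL g /\ forall x y, omega (g *m x) (g *m y) = omega x y].

Definition G0 : set 'M[C]_n :=
  [set g | GL g /\ forall x, gamma (g *m x) = g *m gamma x].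

Definition act (g : 'M[C]_n) (F : chain) : chain :=
  [ffun k => (linfun (mulmx g : V -> V) @: F k)%VS].

Definition orbits (H : set 'M[C]_n) : set (set chain) :=
  [set [set act g F | g in H] | F in X].

Definition matsuki_pairing (Xi : set chain -> set chain) : Prop :=
  set_bij (orbits K) (orbits G0) Xi /\
  forall O, orbits K O -> orbits (K `&` G0) (O `&` Xi O).

(* A map on K-orbits is represented by a map defined on all sets of chains,
   whose values elsewhere are irrelevant. *)
Definition matsuki_duality (Xi : set chain -> set chain) : Prop :=
  matsuki_pairing Xi /\
  forall Xi', matsuki_pairing Xi' -> forall O, orbits K O -> Xi' O = Xi O.

End Defs.

Arguments involutions t {n}.

(* Main.v *)
Require Import Defs.
From HB Require Import structures.
From mathcomp Require Import all_boot all_order all_algebra all_fingroup.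
From mathcomp Require Import boolp classical_sets functions reals.
From mathcomp Require Import complex.
From mathcomp Require Import zify ring.

(** Only three properties of the matrix [Omega] matter: it is real, its
    transpose is [eps *: Omega], and it is orthogonal. Hence [gamma] is an
    antilinear map of square [eps], and h(x, y) = omega(gamma x, y) is the
    standard hermitian product; this link between the two structures is what
    makes the K-orbits and the G^0-orbits correspond.

    Normal forms. Every complete flag is spanned by a basis dual for some
    involution w ([exists_dual]), and also by a basis conjugate for some w
    ([exists_conj]). Both are Gaussian eliminations which change a vector of an
    adapted basis only by a scalar and by vectors lying in earlier steps of the
    flag. The smallest untreated index k is paired with an index m, the position
    of a pivot, and w exchanges k and m. In type A2, m = k cannot occur: omega
    is alternating, and c conj(c) = -1 has no solution.

    The involution is determined by the flag. In the coordinates of a w-dual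
    basis the space orthogonal to a step of the flag is given by the vanishing of
    some coordinates; the same holds for the image of a step under gamma and a
    w-conjugate basis. So the dimensions of their intersections with the steps
    are the counts that define the relative position ([relpos_dual],
    [relpos_conj]), and these counts determine w ([relpos_inj]). With the normal
    forms this gives (b).

    Orbits. The linear map carrying a w-dual basis to another one preserves
    omega, and K carries w-dual bases to w-dual bases; likewise for G^0 and
    conjugate bases, and for the intersection of the groups and bases of both
    kinds ([orbit_flags]). This gives (c).

    Intersections. Let F be spanned by a w-dual and by a w-conjugate basis. For
    all k and l, gamma F_k /\ F_l and F_k^perp /\ F_l are h-orthogonal, and their
    dimensions, read off from the two bases, add up to that of F_l: so F_l is
    their orthogonal sum ([orth_decomposition]). Consequently gamma permutes, up
    to scalars, the vectors of an h-orthonormal basis adapted to F, and it does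
    so according to w ([gamma_orthonormal]); adjusting the phases gives a basis
    of both kinds ([dual_conj_basis]). Conversely an h-orthonormal w-conjugate
    basis is w-dual, and such bases exist for every w ([exists_dual_conj]). This
    gives (a), and shows that w-dual flags go to w-conjugate flags under a
    pairing as in (d).

    Uniqueness of the pairing. If a w-dual flag is also w'-conjugate, the
    orthogonality of gamma F_k /\ F_l and F_k^perp /\ F_l bounds the counts for
    w' by the counts for w ([perm_rank_conj_le_dual]). Another pairing induces an
    injection s of the finite set of involutions into itself with the counts for
    s w at most those for w; along a cycle of s all counts agree, so s w = w
    ([duality_unique]). *)

Set Implicit Arguments.
Unset Strict Implicit.
Unset Printing Implicit Defensive.
#[local] Set Bullet Behavior "Strict Subproofs".

Import Order.TTheory GRing.Theory Num.Theory.

Local Open Scope ring_scope.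
Local Open Scope classical_set_scope.

(** * Adapted bases and coordinates *)
Section Flags.
Variables (R : realType) (n : nat).
Local Notation C := R[i].
Local Notation V := 'cV[C]_n.
Implicit Types (F : chain R n) (v : n.-tuple V) (k j : 'I_n) (x y : V).

Lemma inordn k : (inord k : 'I_n.+1) = k :> nat.
Proof. by rewrite inordK // ltnS ltnW. Qed.

Lemma inordSn k : (inord k.+1 : 'I_n.+1) = k.+1 :> nat.
Proof. by rewrite inordK // ltnS. Qed.

Lemma dim_cV : \dim {:V} = n.
Proof. by rewrite dimvf /dim /= muln1. Qed.

(** Membership in the steps of the flag makes it possible to change one vector
    at a time without mentioning spans; such a family is automatically a basis,
    by [flag_of_adapted]. *)
Definition adapted F (v : 'I_n -> V) :=
  forall k, v k \in F (inord k.+1) /\ v k \notin F (inord k).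

Lemma card_ltn m : (m <= n)%N -> #|[pred j : 'I_n | (j < m)%N]| = m.
Proof.
move=> mn; rewrite -sum1_card -(big_ord_widen n (fun=> 1%N) mn).
by rewrite sum1_card card_ord.
Qed.

Section Basis.
Variable v : n.-tuple V.
Hypothesis bv : basis_of fullv v.

Lemma coord_tnth j k : coord v j (tnth v k) = (j == k)%:R.
Proof. by rewrite (tnth_nth 0) coord_free ?(basis_free bv) // eq_sym. Qed.

Lemma basis_expand x : x = \sum_j coord v j x *: tnth v j.
Proof.
rewrite {1}(coord_basis bv (memvf x)); apply: eq_bigr => j _.
by rewrite (tnth_nth 0).
Qed.

Lemma mem_flag_of (k : 'I_n.+1) x :
  reflect (forall j, (k <= j)%N -> coord v j x = 0) (x \in flag_of v k).
Proof.
rewrite ffunE; apply: (iffP idP) => [xk j kj|c0].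
  suff /subvP/(_ _ xk) :
      (<<take k v>> <= lker (linfun (coord v j : V -> C^o)))%VS.
    by rewrite memv_ker lfunE /= => /eqP.
  apply/span_subvP => y /(nthP 0) [p].
  rewrite size_takel ?size_tuple; last by rewrite -ltnS.
  move=> ik <-; rewrite nth_take // memv_ker lfunE /=.
  have i_n : (p < n)%N by rewrite (leq_trans ik) // -ltnS.
  have -> : v`_p = tnth v (Ordinal i_n) by rewrite (tnth_nth 0).
  rewrite coord_tnth.
  by case: (j =P _) => [E|//]; move: kj; rewrite E leqNgt ik.
rewrite (basis_expand x); apply: memv_suml => j _.
have [/c0 ->|jk] := leqP k j; first by rewrite scale0r mem0v.
apply/memvZ/memv_span; rewrite (tnth_nth 0) -(nth_take 0 jk).
by rewrite mem_nth // size_takel // size_tuple -ltnS.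
Qed.

(** Turns the counts in the definition of relative position into statements about
    coordinates: the intersections that occur are spanned by a subfamily of a dual
    or conjugate basis. *)
Lemma dim_coord (U : {vspace V}) (P : pred 'I_n) :
  (forall x, x \in U <-> forall j, ~~ P j -> coord v j x = 0) ->
  \dim U = #|P|.
Proof.
move=> UE; pose s := [seq tnth v j | j <- enum P].
have us : uniq s.
  rewrite map_inj_uniq ?enum_uniq // => i j /(congr1 (coord v i)).
  rewrite !coord_tnth eqxx; case: eqP => // _ /eqP.
  by rewrite oner_eq0.
have fs : free s.
  have pe : perm_eq s [seq x <- v | x \in s].
    apply: uniq_perm => // [|x].
      by rewrite filter_uniq // free_uniq // (basis_free bv).
    rewrite mem_filter andb_idr // => /mapP[j _ ->]; exact: mem_tnth.
  by rewrite (perm_free pe) filter_free // (basis_free bv).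
suff -> : U = <<s>>%VS by move: fs => /eqP ->; rewrite size_map -cardE.
apply/eqP; rewrite eqEsubv; apply/andP; split.
  apply/subvP => x /UE c0; rewrite (basis_expand x); apply: memv_suml => j _.
  have [Pj|/c0 ->] := boolP (P j); last by rewrite scale0r mem0v.
  by apply/memvZ/memv_span/map_f; rewrite mem_enum.
apply/span_subvP => _ /mapP[j Pj ->]; apply/UE => k Pk; rewrite coord_tnth.
by case: (k =P j) => // kj; move: Pk; rewrite kj -[P j]/(j \in P) -mem_enum Pj.
Qed.

Lemma X_flag_of : X (flag_of v).
Proof.
split=> [k|k l kl].
  rewrite (@dim_coord _ [pred j : 'I_n | (j < k)%N]).
    by rewrite card_ltn // -ltnS.
  move=> x; split=> [/mem_flag_of c0 j|c0]; first by rewrite -leqNgt => /c0.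
  by apply/mem_flag_of => j kj; apply: c0; rewrite -leqNgt.
apply/subvP => x /mem_flag_of c0; apply/mem_flag_of => j lj.
by rewrite c0 // (leq_trans kl).
Qed.

End Basis.

(** Each [v k] enlarges the span of its predecessors, which therefore fills
    [F k.+1] by dimension. *)
Lemma flag_of_adapted F v : X F -> adapted F (tnth v) ->
  basis_of fullv v /\ flag_of v = F.
Proof.
move=> [dF sF] aF.
have E m : (m <= n)%N -> <<take m v>>%VS = F (inord m).
  elim: m => [_|m IH mn].
    apply/eqP; rewrite take0 span_nil eq_sym -dimv_eq0 dF.
    by rewrite inordK.
  pose k := Ordinal mn.
  have [vk vk'] := aF k; rewrite /= in vk vk'.
  have -> : take m.+1 v = rcons (take m v) (tnth v k).
    by rewrite (tnth_nth 0) -take_nth // size_tuple.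
  rewrite -cats1 span_cat span_seq1 (IH (ltnW mn)).
  have Fm : (F (inord m) <= F (inord m.+1))%VS.
    by apply: sF; rewrite !inordK // ltnW.
  apply/eqP; rewrite eqEdim; apply/andP; split.
    by rewrite subv_add Fm -memvE.
  rewrite !dF inordK //.
  have {1}<- : \dim (F (inord m)) = m by rewrite dF inordK // ltnW.
  rewrite ltn_neqAle dimvS ?addvSl // andbT.
  rewrite (dimv_leqif_sup (addvSl _ _)) subv_add subvv /= -memvE; exact: vk'.
split; last first.
  by apply/ffunP => k; rewrite ffunE -[in RHS](inord_val k) E // -ltnS.
rewrite basisEdim size_tuple dim_cV leqnn andbT.
rewrite -[X in <<X>>%VS](@take_size _ v) size_tuple E // -dimv_leqif_sup //;
  last exact: subvf.
by rewrite dF inordK // dim_cV.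
Qed.
End Flags.

(** * The bilinear form, the conjugation and the hermitian form *)
Section Eps.
Variables (R : realType) (t : typeA).
Local Notation eps := (eps R t).

Lemma epsM : eps * eps = 1.
Proof. by rewrite /eps; case: t; rewrite ?mulr1 // mulrNN mulr1. Qed.

Lemma conj_eps : conjc eps = eps.
Proof. by rewrite /eps; case: t; rewrite ?rmorphN rmorph1. Qed.

Lemma eps_neq0 : eps != 0.
Proof. by rewrite /eps; case: t; rewrite ?oppr_eq0 oner_eq0. Qed.

(** The equations behind gamma^2 = eps and behind the formula [hmE] for h, stated
    for an arbitrary matrix so that they can be proved block by block. *)
Definition compatible n (S : 'M[R[i]]_n) :=
  [/\ S^T = eps *: S, map_mx (@conjc R) S = S & S^T *m S = 1%:M].

Lemma block_compatible m n (A : 'M_m) (B : 'M_n) :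
  compatible A -> compatible B -> compatible (block_mx A 0 0 B).
Proof.
move=> [At Ac A1] [Bt Bc B1]; split.
- by rewrite tr_block_mx At Bt !trmx0 scale_block_mx !scaler0.
- by rewrite map_block_mx Ac Bc !map_mx0.
- by rewrite tr_block_mx mulmx_block !trmx0 !mul0mx !mulmx0 !addr0 add0r A1 B1
     -scalar_mx_block.
Qed.

Lemma standard_compatible n (S : 'M[R[i]]_n) :
  standard_form t S -> compatible S.
Proof.
elim=> {n S} [|n A _ IH|n A t1 _ IH].
- by split; apply/matrixP => -[].
- apply: block_compatible IH; split;
  apply/matrixP => -[[|[|k]] ?] [[|[|l]] ?] //;
    rewrite !mxE ?big_ord_recl ?big_ord0 ?mxE /=;
    rewrite ?mulr0 ?mul0r ?mulr1 ?mul1r ?addr0 ?add0r ?epsM ?conj_eps ?rmorph0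
      ?rmorph1 ?oppr0 //=.
- apply: block_compatible IH; split.
  + by rewrite trmx1 /Defs.eps t1 scale1r.
  + by rewrite map_mx1.
  + by rewrite trmx1 mulmx1.
Qed.
End Eps.

Section Forms.
Variables (R : realType) (t : typeA) (n : nat) (Omega : 'M[R[i]]_n).
Local Notation C := R[i].
Local Notation V := 'cV[C]_n.
Local Notation eps := (eps R t).
Local Notation om := (omega Omega).
Local Notation ga := (gamma Omega).
Implicit Types (x y z : V) (a b : C).

Lemma omDl x y z : om (x + y) z = om x z + om y z.
Proof. by have := omega_is_linearl Omega z 1 x y; rewrite !scale1r. Qed.

Lemma omDr z x y : om z (x + y) = om z x + om z y.
Proof. by have := omega_is_linearr Omega z 1 x y; rewrite !scale1r. Qed.

Lemma om0l z : om 0 z = 0.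
Proof. by rewrite /omega trmx0 !mul0mx mxE. Qed.

Lemma om0r z : om z 0 = 0.
Proof. by rewrite /omega mulmx0 mxE. Qed.

Lemma omZl a x z : om (a *: x) z = a * om x z.
Proof.
by have := omega_is_linearl Omega z a x 0; rewrite !addr0 om0l addr0.
Qed.

Lemma omZr z a x : om z (a *: x) = a * om z x.
Proof.
by have := omega_is_linearr Omega z a x 0; rewrite !addr0 om0r addr0.
Qed.

Lemma omNr z x : om z (- x) = - om z x.
Proof. by rewrite -scaleN1r omZr mulN1r. Qed.

Lemma om_suml (I : finType) (f : I -> V) z :
  om (\sum_i f i) z = \sum_i om (f i) z.
Proof. by rewrite (big_morph (om^~ z) (fun x y => omDl x y z) (om0l z)). Qed.

Lemma om_sumr (I : finType) z (f : I -> V) :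
  om z (\sum_i f i) = \sum_i om z (f i).
Proof. by rewrite (big_morph (om z) (omDr z) (om0r z)). Qed.

Lemma gaD x y : ga (x + y) = ga x + ga y.
Proof. by rewrite /gamma raddfD /= mulmxDr. Qed.

Lemma gaZ a x : ga (a *: x) = conjc a *: ga x.
Proof.
rewrite /gamma scalemxAr; congr (_ *m _).
by apply/matrixP => p q; rewrite !mxE /= rmorphM.
Qed.

Lemma ga0 : ga 0 = 0. Proof. by rewrite /gamma raddf0 /= mulmx0. Qed.

Lemma ga_sum (I : finType) (f : I -> V) : ga (\sum_i f i) = \sum_i ga (f i).
Proof. by rewrite (big_morph ga gaD ga0). Qed.

(** By [hmE] this is the standard hermitian product, antilinear on the left. *)
Definition hform x y := om (ga x) y.
Local Notation hm := hform.

Lemma hm0r x : hm x 0 = 0. Proof. exact: om0r. Qed.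

Lemma hmDr z x y : hm z (x + y) = hm z x + hm z y. Proof. exact: omDr. Qed.

Lemma hmZr z a x : hm z (a *: x) = a * hm z x. Proof. exact: omZr. Qed.

Lemma hmZl a x z : hm (a *: x) z = conjc a * hm x z.
Proof. by rewrite /hform gaZ omZl. Qed.

Hypothesis compO : compatible t Omega.

Lemma om_sym x y : om y x = eps * om x y.
Proof.
case: compO => Ot _ _; rewrite /omega.
rewrite -[LHS]/(((y^T *m Omega *m x)) 0 0) -[y^T *m _ *m x]trmxK [in LHS]mxE.
by rewrite !trmx_mul trmxK Ot -scalemxAl -scalemxAr mulmxA mxE.
Qed.

Lemma om_alt x : t = TypeA2 -> om x x = 0.
Proof.
move=> t2; have := om_sym x x; rewrite /Defs.eps t2 mulN1r => /eqP.
by rewrite -addr_eq0 -mulr2n mulrn_eq0 => /eqP.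
Qed.

Lemma OmegaM : Omega *m Omega = eps%:M.
Proof.
case: compO => Ot _ O1; move: O1; rewrite Ot -scalemxAl.
move=> /(congr1 ( *:%R eps)).
by rewrite scalerA epsM scale1r => ->; rewrite scale_scalar_mx mulr1.
Qed.

Lemma gaK x : ga (ga x) = eps *: x.
Proof.
case: compO => _ Oc _; rewrite /gamma map_mxM Oc mulmxA OmegaM mul_scalar_mx.
by congr (_ *: _); apply/matrixP => p q; rewrite !mxE; exact: conjcK.
Qed.

Lemma hmE x y : hm x y = \sum_i conjc (x i 0) * y i 0.
Proof.
case: compO => _ _ O1; rewrite /hform /omega /gamma trmx_mul.
rewrite -[_ *m Omega^T *m _]mulmxA.
by rewrite O1 mulmx1 mxE; apply: eq_bigr => p _; rewrite !mxE.
Qed.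

Lemma hm_sym x y : hm y x = conjc (hm x y).
Proof.
by rewrite !hmE rmorph_sum; apply: eq_bigr => p _;
  rewrite rmorphM /= conjcK mulrC.
Qed.

Lemma hm_ge0 x : 0 <= hm x x.
Proof.
by rewrite hmE; apply: sumr_ge0 => p _; rewrite mulrC; exact: mul_conjC_ge0.
Qed.

Lemma hm_eq0 x : hm x x = 0 -> x = 0.
Proof.
rewrite hmE => /eqP; rewrite psumr_eq0 => [/allP x0|p _]; last first.
  by rewrite mulrC; exact: mul_conjC_ge0.
apply/matrixP => p q; rewrite ord1 mxE; apply/eqP.
by rewrite -mul_conjC_eq0 mulrC; exact: (x0 p (mem_index_enum p)).
Qed.

Lemma om_ga x y : om (ga x) (ga y) = conjc (om x y).
Proof.
by rewrite -/(hm x (ga y)) hm_sym /hform gaK omZl (om_sym x y) mulrA epsM mul1r.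
Qed.

Lemma hm_ga x y : hm (ga x) (ga y) = conjc (hm x y).
Proof. by rewrite /hform om_ga. Qed.

Lemma om_nondeg x : (forall y, om x y = 0) -> x = 0.
Proof.
move=> x0; apply: hm_eq0; rewrite hm_sym /hform om_sym x0 mulr0; exact: rmorph0.
Qed.

(** For x = gamma y with y in U, gamma x = eps y gives h(x, x) = omega(x, y),
    which vanishes when x is orthogonal to U; and h is definite. *)
Lemma gamma_orth_disjoint (U : {vspace V}) x :
  x \in gammav Omega U -> x \in orthv Omega U -> x = 0.
Proof.
move=> /memv_gammav[y yU xy] /memv_orthv ox; apply: hm_eq0.
by rewrite /hform {1}xy gaK omZl om_sym ox // !mulr0.
Qed.

End Forms.

(** * Relative positions of dual and conjugate flags *)
Section RelPos.
Variables (R : realType) (n : nat).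
Implicit Types (u w : 'S_n).

Lemma card_perm_ltn u m : (m <= n)%N -> #|[pred j : 'I_n | (u j < m)%N]| = m.
Proof.
move=> mn; rewrite -[RHS](card_ltn mn) -!sum1_card.
by rewrite [RHS](reindex_inj (@perm_inj _ u)).
Qed.

Definition perm_rank w (k l : nat) :=
  #|[pred j : 'I_n | (j < l)%N & (w j < k)%N]|.

Lemma perm_rankS w k (j : 'I_n) :
  perm_rank w k j.+1 = ((w j < k) + perm_rank w k j)%N.
Proof.
rewrite /perm_rank (cardD1 j) !inE ltnSn; congr addn; apply: eq_card => p.
rewrite !inE; case: (p =P j) => [->|pj]; first by rewrite ltnn.
by rewrite /= ltnS leq_eqVlt; case: (_ =P _) => // /val_inj.
Qed.

(** The increment of [perm_rank w k] between [j] and [j.+1] tells whether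
    [w j < k]. *)
Lemma perm_rank_inj w w' :
  (forall k l : 'I_n.+1, perm_rank w k l = perm_rank w' k l) -> w = w'.
Proof.
move=> e.
have lt_eq (j k : 'I_n) : (w j <= k)%N = (w' j <= k)%N.
  have := e (inord k.+1) (inord j.+1).
  rewrite !inordSn !perm_rankS; have := e (inord k.+1) (inord j).
  rewrite inordSn inordn => -> /addIn; rewrite !ltnS.
  by case: (w j <= k)%N; case: (w' j <= k)%N.
apply/permP => j; apply/val_inj/eqP; rewrite eqn_leq.
by rewrite -lt_eq leqnn lt_eq leqnn.
Qed.

Lemma relpos_inj w w' (P : chain R n * chain R n) :
  relpos w P -> relpos w' P -> w = w'.
Proof.
move=> [_ _ e] [_ _ e']; apply: perm_rank_inj => k l.
by rewrite /perm_rank -e -e'.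
Qed.
End RelPos.

Section Pos.
Variables (R : realType) (t : typeA) (n : nat) (Omega : 'M[R[i]]_n).
Local Notation C := R[i].
Local Notation V := 'cV[C]_n.
Local Notation eps := (eps R t).
Local Notation om := (omega Omega).
Local Notation ga := (gamma Omega).
Hypothesis compO : compatible t Omega.
Variables (w : 'S_n) (v : n.-tuple V).
Hypothesis ww : forall k, w (w k) = k.

(** The Gram matrix of a w-dual basis. *)
Definition dual_gram (k l : 'I_n) : C :=
  if w k == l then (if (k <= l)%N then 1 else eps) else 0.

Lemma dual_gram_neq0 k : dual_gram k (w k) != 0.
Proof. by rewrite /dual_gram eqxx; case: ifP; rewrite ?oner_eq0 ?eps_neq0. Qed.

Lemma dual_gram_eq0 k l : w k != l -> dual_gram k l = 0.
Proof. by rewrite /dual_gram => /negbTE ->. Qed.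

Section Dual.
Hypothesis dv : w_dual t Omega w v.
Let bv : basis_of fullv v. Proof. by case: dv. Qed.

Lemma om_dual k l : om (tnth v k) (tnth v l) = dual_gram k l.
Proof. by case: dv => _; apply. Qed.

(** Pairing with [v l] extracts the coordinate at the partner [w l]. *)
Lemma om_coord x (l : 'I_n) :
  om x (tnth v l) = coord v (w l) x * dual_gram (w l) l.
Proof.
rewrite {1}(basis_expand bv x) om_suml (bigD1 (w l)) //= big1 ?addr0 => [|j jl].
  by rewrite omZl om_dual.
rewrite omZl om_dual dual_gram_eq0 ?mulr0 //.
by apply: contraNneq jl => <-; rewrite ww.
Qed.

Lemma mem_orth_flag (k : 'I_n.+1) x :
  x \in orthv Omega (flag_of v k) <->
  forall j, (w j < k)%N -> coord v j x = 0.
Proof.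
split=> [/memv_orthv x0 j jk|c0].
  have : om x (tnth v (w j)) = 0.
    apply: x0; apply/(mem_flag_of bv) => l kl; rewrite (coord_tnth bv).
    by case: (l =P w j) => // E; move: kl; rewrite E leqNgt jk.
  rewrite om_coord ww => /eqP; rewrite mulf_eq0.
  by have := dual_gram_neq0 j => /negbTE ->; rewrite orbF => /eqP.
apply/memv_orthv => y /(mem_flag_of bv) y0.
rewrite (basis_expand bv y) om_sumr big1 // => j _; rewrite omZr om_coord.
have [/y0 ->|jk] := leqP k j; first by rewrite mul0r.
by rewrite c0 ?ww // mul0r mulr0.
Qed.

Lemma dim_orth_flag (k l : 'I_n.+1) :
  \dim (orthv Omega (flag_of v k) :&: flag_of v l) =
  #|[pred j : 'I_n | (j < l)%N & ~~ (w j < k)%N]|.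
Proof.
apply: (dim_coord bv) => x; rewrite memv_cap.
split=> [/andP[/mem_orth_flag c0 /(mem_flag_of bv) c1] j|c0].
  by rewrite negb_and negbK -leqNgt => /orP[/c1|/c0].
apply/andP; split; [apply/mem_orth_flag|apply/(mem_flag_of bv)];
  by move=> j jk; apply: c0; rewrite negb_and negbK -leqNgt jk ?orbT.
Qed.

Lemma relpos_dual :
  relpos (w0_after w) (orth_chain Omega (flag_of v), flag_of v).
Proof.
have E (k : 'I_n.+1) j : (w0_after w j < k)%N = ~~ (w j < rev_ord k)%N.
  rewrite permM permE /=; have := ltn_ord (w j); have := ltn_ord k; lia.
split=> [||k l] /=; last 1 first.
- by rewrite ffunE dim_orth_flag; apply: eq_card => j; rewrite !inE E.
- split=> [k|k l kl].
    rewrite -[RHS](@card_perm_ltn n (w0_after w)); last by rewrite -ltnS.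
    apply: (dim_coord bv) => x; rewrite ffunE mem_orth_flag.
    by split=> c0 j jk; apply: c0; move: jk; rewrite /= E negbK.
  apply/subvP => x; rewrite [orth_chain _ _ k]ffunE [orth_chain _ _ l]ffunE.
  move=> /mem_orth_flag c0.
  by apply/mem_orth_flag => j jl; apply: c0;
    rewrite (leq_trans jl) //= leq_sub2l.
- exact: X_flag_of.
Qed.
End Dual.

Section Conj.
Hypothesis cv : w_conjugate t Omega w v.
Let bv : basis_of fullv v. Proof. by case: cv. Qed.

Definition conj_sign (k : 'I_n) : C := if (k <= w k)%N then eps else 1.

Lemma conj_sign_neq0 k : conj_sign k != 0.
Proof. by rewrite /conj_sign; case: ifP; rewrite ?oner_eq0 ?eps_neq0. Qed.

Lemma ga_conj k : ga (tnth v k) = conj_sign k *: tnth v (w k).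
Proof.
by case: cv => _ ->; rewrite /conj_sign; case: ifP; rewrite ?scale1r.
Qed.

Lemma coord_ga x j :
  coord v j (ga x) = conj_sign (w j) * conjc (coord v (w j) x).
Proof.
rewrite {1}(basis_expand bv x) ga_sum linear_sum (bigD1 (w j)) //=.
rewrite big1 ?addr0 => [|l lj]; rewrite gaZ ga_conj !linearZ /= (coord_tnth bv).
  by rewrite ww eqxx mulr1 mulrC.
by case: (j =P w l) => [E|]; rewrite ?mulr0 //; move: lj; rewrite E ww eqxx.
Qed.

Lemma mem_gamma_flag (k : 'I_n.+1) x :
  x \in gammav Omega (flag_of v k) <->
  forall j, (k <= w j)%N -> coord v j x = 0.
Proof.
split=> [/memv_gammav[y /(mem_flag_of bv) y0 ->] j jk|c0].
  by rewrite coord_ga y0 // conjc0 mulr0.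
apply/memv_gammav; exists (eps *: ga x).
  apply/memvZ/(mem_flag_of bv) => j jk.
  by rewrite coord_ga c0 ?ww // conjc0 mulr0.
by rewrite gaZ conj_eps (gaK compO) scalerA epsM scale1r.
Qed.

Lemma dim_gamma_flag (k l : 'I_n.+1) :
  \dim (gammav Omega (flag_of v k) :&: flag_of v l) = perm_rank w k l.
Proof.
apply: (dim_coord bv) => x; rewrite memv_cap.
split=> [/andP[/mem_gamma_flag c0 /(mem_flag_of bv) c1] j|c0].
  by rewrite negb_and -!leqNgt => /orP[/c1|/c0].
apply/andP; split; [apply/mem_gamma_flag|apply/(mem_flag_of bv)];
  by move=> j jk; apply: c0; rewrite negb_and -!leqNgt jk ?orbT.
Qed.

Lemma relpos_conj : relpos w (gamma_chain Omega (flag_of v), flag_of v).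
Proof.
split=> [||k l] /=; last by rewrite ffunE dim_gamma_flag.
- split=> [k|k l kl].
    rewrite -[RHS](@card_perm_ltn n w); last by rewrite -ltnS.
    apply: (dim_coord bv) => x; rewrite ffunE mem_gamma_flag.
    by split=> c0 j jk; apply: c0; move: jk; rewrite -leqNgt.
  apply/subvP => x; rewrite [gamma_chain _ _ k]ffunE [gamma_chain _ _ l]ffunE.
  move=> /mem_gamma_flag c0.
  by apply/mem_gamma_flag => j jl; apply: c0; rewrite (leq_trans kl).
- exact: X_flag_of.
Qed.
End Conj.
End Pos.

Section TwoBases.
Variables (R : realType) (t : typeA) (n : nat) (Omega : 'M[R[i]]_n).
Local Notation V := 'cV[R[i]]_n.
Hypothesis compO : compatible t Omega.
Variables (w w' : 'S_n) (v v' : n.-tuple V).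
Hypotheses (ww : forall k, w (w k) = k) (ww' : forall k, w' (w' k) = k).
Hypotheses (dv : w_dual t Omega w v) (cv : w_conjugate t Omega w' v').
Hypothesis vv' : flag_of v' = flag_of v.
Let F := flag_of v.

(** The two spaces meet trivially by [gamma_orth_disjoint], so the dimensions
    given by the two bases add up. *)
Lemma dim_gamma_orth (k l : 'I_n.+1) :
  \dim ((gammav Omega (F k) :&: F l) + (orthv Omega (F k) :&: F l)) =
  (perm_rank w' k l + #|[pred j : 'I_n | (j < l)%N & ~~ (w j < k)%N]|)%N.
Proof.
rewrite dimv_disjoint_sum; last first.
  apply/eqP; rewrite -subv0; apply/subvP => x; rewrite !memv_cap memv0.
  by case/andP => /andP[xg _] /andP[xo _];
    apply/eqP/(gamma_orth_disjoint compO xg xo).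
by rewrite (dim_orth_flag ww dv) /F -vv' (dim_gamma_flag compO ww' cv).
Qed.

Lemma card_flag (k l : 'I_n.+1) :
  \dim (F l) =
  (perm_rank w k l + #|[pred j : 'I_n | (j < l)%N & ~~ (w j < k)%N]|)%N.
Proof.
have [bv _] := dv; have [-> _] := X_flag_of bv.
rewrite -[LHS](@card_ltn n); last by rewrite -ltnS.
rewrite -(cardID [pred j : 'I_n | (w j < k)%N] [pred j : 'I_n | (j < l)%N]).
congr (_ + _)%N; apply: eq_card => j; rewrite !inE //.
exact: andbC.
Qed.

(** The direct sum of [dim_gamma_orth] lies in [F l]. This comparison of two
    involutions attached to one flag is what forces the duality to be unique. *)
Lemma perm_rank_conj_le_dual (k l : 'I_n.+1) :
  (perm_rank w' k l <= perm_rank w k l)%N.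
Proof.
rewrite -(leq_add2r #|[pred j : 'I_n | (j < l)%N & ~~ (w j < k)%N]|).
by rewrite -dim_gamma_orth -card_flag dimvS // subv_add !capvSr.
Qed.
End TwoBases.

(** * Normal forms of flags *)

(** Induction principle of the eliminations below: a partial solution on a set of
    treated indices, extended at the smallest untreated index. *)
Lemma exhaust n (T : Type) (P : T -> {set 'I_n} -> Prop) s0 :
  P s0 finset.set0 ->
  (forall s D k, P s D -> k \notin D ->
     (forall j : 'I_n, (j < k)%N -> j \in D) ->
     exists s' D', P s' D' /\ D \proper D') ->
  exists s, P s finset.setT.
Proof.
move=> P0 step.
suff grow N : forall (D : {set 'I_n}) s, (#|~: D| < N)%N -> P s D ->
    exists s, P s finset.setT by exact: grow (ltnSn _) P0.
elim: N => // N IH D s; rewrite ltnS => DN PD.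
have [DT|] := eqVneq D finset.setT; first by exists s; rewrite -DT.
rewrite -finset.subTset => /subsetPn[k0 _ k0D].
case: (@arg_minnP _ k0 [pred k | k \notin D] val k0D) => k kD kmin.
have [j jk|s' [D' [PD' DD']]] := step _ _ _ PD kD.
  by apply: contraLR jk => /kmin /=; rewrite -leqNgt.
apply: IH (leq_trans _ DN) PD'.
by apply: proper_card; rewrite properE !finset.setCS -properE.
Qed.

Section Grow.
Variables (R : realType) (t : typeA) (n : nat) (Omega : 'M[R[i]]_n).
Local Notation C := R[i].
Local Notation V := 'cV[C]_n.
Local Notation eps := (eps R t).
Local Notation om := (omega Omega).
Local Notation ga := (gamma Omega).
Local Notation dual_gram := (@dual_gram R t n).
Hypothesis compO : compatible t Omega.
Variable F : chain R n.
Hypothesis XF : X F.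

Lemma flag_le p q : (p <= q <= n)%N -> (F (inord p) <= F (inord q))%VS.
Proof.
case: XF => _ sF /andP[pq qn]; apply: sF; rewrite !inordK //.
exact: leq_trans pq qn.
Qed.

Lemma flag_up p q x : (p <= q <= n)%N -> x \in F (inord p) -> x \in F (inord q).
Proof. by move=> pq; apply/subvP/flag_le. Qed.

Lemma adaptedD (j : 'I_n) x y :
  x \in F (inord j.+1) /\ x \notin F (inord j) -> y \in F (inord j) ->
  x + y \in F (inord j.+1) /\ x + y \notin F (inord j).
Proof.
move=> [xj xj'] yj; split; last by rewrite rpredDr.
by rewrite rpredD // (flag_up _ yj) // leqnSn ltn_ord.
Qed.

Lemma adaptedZ (j : 'I_n) x c : c != 0 ->
  x \in F (inord j.+1) /\ x \notin F (inord j) ->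
  c *: x \in F (inord j.+1) /\ c *: x \notin F (inord j).
Proof.
move=> c0 [xj xj']; split; first exact: memvZ.
by apply: contra xj' => /(memvZ c^-1); rewrite scalerK.
Qed.

Lemma exists_adapted : exists v, adapted F v.
Proof.
have /choice[v av] (j : 'I_n) :
    exists x, x \in F (inord j.+1) /\ x \notin F (inord j).
  have [dF _] := XF.
  have /subvPn[x xj xj'] : ~~ (F (inord j.+1) <= F (inord j))%VS.
    by apply/negP => /dimvS; rewrite !dF inordn inordSn ltnn.
  by exists x.
by exists v.
Qed.

Section Adapted.
Variable v : 'I_n -> V.
Hypothesis av : adapted F v.
Local Notation b := (mktuple v).

Lemma adapted_mktuple : basis_of fullv b /\ flag_of b = F.
Proof. by apply: flag_of_adapted => // k; rewrite tnth_mktuple; exact: av. Qed.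

Lemma adapted_basis : basis_of fullv b. Proof. by case: adapted_mktuple. Qed.

Lemma adapted_expand x : x = \sum_j coord b j x *: v j.
Proof.
rewrite {1}(basis_expand adapted_basis x).
by apply: eq_bigr => j _; rewrite tnth_mktuple.
Qed.

Lemma coord_adapted j k : coord b j (v k) = (j == k)%:R.
Proof. by rewrite -(coord_tnth adapted_basis) tnth_mktuple. Qed.

Lemma mem_adapted p x : (p <= n)%N ->
  reflect (forall j : 'I_n, (p <= j)%N -> coord b j x = 0) (x \in F (inord p)).
Proof.
move=> pn; rewrite -(proj2 adapted_mktuple).
by apply: (iffP (mem_flag_of adapted_basis _ _)); rewrite inordK.
Qed.

(** Guarantees a pivot in [dual_step]. *)
Lemma adapted_nondeg k : (forall l, om (v k) (v l) = 0) -> False.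
Proof.
move=> k0; have [_] := av k; suff -> : v k = 0 by rewrite mem0v.
apply: (om_nondeg compO) => y; rewrite (adapted_expand y) om_sumr.
by rewrite big1 // => j _; rewrite omZr k0 mulr0.
Qed.
End Adapted.

(** The vectors with index in D already satisfy the w-dual relations with all
    vectors; outside D the permutation is still trivial. *)
Definition dual_state (vw : ('I_n -> V) * 'S_n) (D : {set 'I_n}) :=
  let: (v, w) := vw in
  [/\ adapted F v, forall k, w (w k) = k, forall k, k \notin D -> w k = k,
      t = TypeA2 -> forall k, k \in D -> w k != k &
      forall k l, k \in D -> om (v k) (v l) = dual_gram w k l].

(** The pivot is the smallest untreated [m] with omega(v_k, v_m) <> 0. If
    [m = k] the line of [v k] is split off, otherwise the hyperbolic plane of
    [v k] and [v m]. Projecting [v j] orthogonally involves [v m] only when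
    omega(v_k, v_j) is nonzero, hence only for [j > m]: the basis stays
    adapted. *)
Lemma dual_step vw D k :
  dual_state vw D -> k \notin D -> (forall j : 'I_n, (j < k)%N -> j \in D) ->
  exists vw' D', dual_state vw' D' /\ D \proper D'.
Proof.
case: vw => v w [av ww wf wA pv] kD kmin.
have wD j : j \in D -> w j \in D.
  by move=> jD; apply: contraT => wj; have := wf _ wj; rewrite ww => E;
    move: wj; rewrite -E jD.
have DN i j : i \in D -> j \notin D -> om (v i) (v j) = 0.
  move=> iD jD; rewrite pv // dual_gram_eq0 //.
  by apply: contraNneq jD => <-; exact: wD.
have ND i j : i \in D -> j \notin D -> om (v j) (v i) = 0.
  by move=> iD jD; rewrite (om_sym compO) DN // mulr0.
have neqD i j : i \in D -> j \notin D -> (i == j) = false.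
  by move=> iD jD; apply: contraNF jD => /eqP<-.
have kle j : j \notin D -> (k <= j)%N.
  by apply: contraR; rewrite -ltnNge => /kmin.
pose Q := [pred m : 'I_n | (m \notin D) && (om (v k) (v m) != 0)].
have [m0 Qm0] : exists m, Q m.
  apply: contrapT => nQ; apply: (adapted_nondeg av (k := k)) => l.
  have [lD|lD] := boolP (l \in D); first exact: ND.
  by apply: contrapT => l0; apply: nQ; exists l; rewrite /= lD; apply/eqP.
case: (@arg_minnP _ m0 Q val Qm0) => m /andP[mD m_neq0] mmin.
have {}mmin (j : 'I_n) : j \notin D -> om (v k) (v j) != 0 -> (m <= j)%N.
  by move=> jD j0; apply: mmin; apply/andP.
have [mk|] := eqVneq m k.
- subst m => {m0 Qm0}; have t1 : t = TypeA1.
    by case E : t => //; rewrite (om_alt compO) ?eqxx in m_neq0.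
  set c := om (v k) (v k) in m_neq0.
  pose s := (sqrtC c)^-1; have s0 : s != 0 by rewrite invr_eq0 sqrtC_eq0.
  pose u := s *: v k.
  have uu : om u u = 1.
    have c2 : c = sqrtC c * sqrtC c by rewrite -expr2 sqrtCK.
    by rewrite omZl omZr -/c [X in _ * (_ * X)]c2 mulKf ?mulVf ?sqrtC_eq0.
  pose v' j := if j == k then u else if j \in D then v j
    else v j - om u (v j) *: u.
  exists (v', w), (k |: D); split; last first.
    by rewrite properE finset.subsetUr; apply/subsetPn; exists k;
      rewrite // !inE eqxx.
  split=> //.
  + move=> j; rewrite /v'; case: ifPn => [/eqP ->|jk]; first exact: adaptedZ.
    case: ifPn => // jD; apply: adaptedD => //; rewrite -scaleNr; apply: memvZ.
    have [+ _] := adaptedZ s0 (av k); apply: flag_up.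
    by rewrite ltn_neqAle eq_sym jk kle //= ltnW.
  + by move=> j; rewrite !inE negb_or => /andP[_ /wf].
  + by rewrite t1.
  + move=> i l; rewrite !inE => /predU1P[->{i}|iD].
    * rewrite {1}/v' eqxx /v'; case: ifPn => [/eqP ->|lk].
        by rewrite uu /dual_gram wf // eqxx leqnn.
      rewrite dual_gram_eq0 ?wf 1?eq_sym //; case: ifPn => lD.
        by rewrite omZl ND ?mulr0.
      by rewrite omDr omNr omZr uu mulr1 subrr.
    * rewrite {1}/v' neqD // iD /v'; case: ifPn => [/eqP ->|lk].
        by rewrite omZr pv // dual_gram_eq0 ?mulr0 // neqD // wD.
      case: ifPn => lD; first exact: pv.
      by rewrite omDr omNr !omZr !DN // !mulr0 subr0 dual_gram_eq0 // neqD // wD.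
- move=> mk; have km : (k < m)%N by rewrite ltn_neqAle eq_sym mk kle.
  set a := v k in mmin m_neq0.
  have aa : om a a = 0.
    by apply: contrapT => /eqP/(mmin k kD); rewrite leqNgt km.
  (* [b0] is normalized against [a]; subtracting half of omega(b0, b0) times [a]
     makes it isotropic, since omega(a, b0) + omega(b0, a) = 2 in type A1, while
     omega(b0, b0) = 0 in type A2. *)
  pose b0 := (om a (v m))^-1 *: v m.
  have ab0 : om a b0 = 1 by rewrite omZr mulVf.
  have b0a : om b0 a = eps by rewrite (om_sym compO) ab0 mulr1.
  pose c := om b0 b0; pose b := b0 - (c / 2) *: a.
  have ab : om a b = 1 by rewrite omDr omNr omZr aa ab0 mulr0 subr0.
  have ba : om b a = eps by rewrite (om_sym compO) ab mulr1.
  have bb : om b b = 0.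
    have bb0 : om b b0 = c - c / 2.
      by rewrite /b -scaleNr omDl (omZl _ (- (c / 2))) ab0 mulr1.
    rewrite [in X in om _ X]/b omDr omNr omZr ba bb0.
    rewrite /c; case E : t; last by rewrite (om_alt compO) // !mul0r !subr0.
    by rewrite /Defs.eps mulr1 -addrA -opprD -splitr subrr.
  pose v' j := if j == m then b else if (j == k) || (j \in D) then v j
    else v j - om a (v j) *: b - (eps * om b (v j)) *: a.
  pose w' := (tperm k m * w)%g.
  have w'k : w' k = m by rewrite permM tpermL wf.
  have w'm : w' m = k by rewrite permM tpermR wf.
  have w'N j : j != k -> j != m -> w' j = w j.
    by move=> jk jm; rewrite permM tpermD // eq_sym.
  have v'k : v' k = a by rewrite /v' eq_sym (negbTE mk) eqxx.
  have v'm : v' m = b by rewrite /v' eqxx.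
  have v'D j : j \in D -> v' j = v j.
    by move=> jD; rewrite /v' neqD // jD orbT.
  have b_m : b \in F (inord m.+1) /\ b \notin F (inord m).
    rewrite /b -scaleNr; apply: adaptedD; first by apply: adaptedZ;
      rewrite ?invr_eq0.
    apply: memvZ; have [+ _] := av k; apply: flag_up.
    by rewrite km ltnW.
  have aD j : j \in D -> om a (v j) = 0 by move=> jD; rewrite ND.
  have bD j : j \in D -> om b (v j) = 0.
    by move=> jD; rewrite /b -scaleNr omDl !omZl !(ND j) // !mulr0 addr0.
  have Db j : j \in D -> om (v j) b = 0.
    by move=> jD; rewrite (om_sym compO) bD // mulr0.
  clearbody b.
  exists (v', w'), (k |: (m |: D)); split; last first.
    rewrite properE finset.setUA finset.subsetUr; apply/subsetPn; exists k;
      rewrite // !inE eqxx //.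
  split.
  + move=> j; rewrite /v'; case: ifPn => [/eqP -> //|jm];
    case: ifPn => // /norP[jk jD].
    have kj : (k < j)%N by rewrite ltn_neqAle eq_sym jk kle.
    apply: adaptedD; last first.
      rewrite -scaleNr; apply: memvZ; have [+ _] := av k; apply: flag_up.
      by rewrite kj ltnW.
    apply: adaptedD => //; rewrite -scaleNr.
    have [->|j0] := eqVneq (om a (v j)) 0; first by rewrite oppr0 scale0r mem0v.
    apply: memvZ; have [+ _] := b_m; apply: flag_up.
    by rewrite ltn_neqAle eq_sym jm mmin //= ltnW.
  + move=> j; have [->|jk] := eqVneq j k; first by rewrite w'k w'm.
    have [->|jm] := eqVneq j m; first by rewrite w'm w'k.
    rewrite (w'N j) // w'N ?ww //; apply: contraNneq (kD).
      by move=> wjk; move: jk; rewrite -[j]ww wjk wf ?eqxx.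
    by move=> wjm; move: jm; rewrite -[j]ww wjm wf ?eqxx.
  + by move=> j; rewrite !inE !negb_or => /and3P[jk jm jD]; rewrite w'N ?wf.
  + move=> t2 j; rewrite !inE => /or3P[/eqP ->|/eqP ->|jD]; rewrite ?w'k ?w'm //.
      by rewrite eq_sym.
    by rewrite w'N ?wA //; apply/negbT/neqD.
  + move=> i l; rewrite !inE => /or3P[/eqP ->|/eqP ->|iD].
    * rewrite v'k /dual_gram w'k; case: eqP => [<-|/eqP ml];
      first by rewrite v'm ltnW.
      rewrite /v' eq_sym (negbTE ml); case: ifPn => [/orP[/eqP ->|lD] //|_].
        by rewrite aD.
      by rewrite !(omDr, omNr, omZr) ab aa !mulr0 mulr1 subr0 subrr.
    * rewrite v'm /dual_gram w'm; case: eqP => [<-|/eqP kl];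
      first by rewrite v'k leqNgt km.
      rewrite /v'; case: ifPn => [_ //|ml].
      rewrite eq_sym (negbTE kl) /=; case: ifPn => lD; first by rewrite bD.
      rewrite !(omDr, omNr, omZr) bb ba mulr0 subr0 mulrAC epsM mul1r subrr //.
    * rewrite v'D // /dual_gram w'N; [|exact/negbT/neqD..];
      rewrite -/(dual_gram w i l) /v'.
      have pat0 j : j \notin D -> dual_gram w i j = 0.
      by move=> jD; rewrite dual_gram_eq0 // neqD // wD.
      have ia : om (v i) a = 0 by rewrite DN.
      case: ifPn => [/eqP ->|lm]; first by rewrite pat0 // Db.
      case: ifPn => [_|/norP[_ lD]]; first exact: pv.
      by rewrite !(omDr, omNr, omZr) ia Db // DN // !mulr0 !subr0 pat0.
Qed.

Lemma exists_dual : exists w v,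
  [/\ involutions t w, w_dual t Omega w v & flag_of v = F].
Proof.
have [v0 av0] := exists_adapted.
have [|[v w] [av ww _ wA pv]] := @exhaust n _ dual_state (v0, 1%g) _ dual_step.
  by split=> // [k|k _|_ k|k l]; rewrite ?inE ?perm1.
have [bv Fv] := adapted_mktuple av.
exists w, (mktuple v); split=> //; first by split=> // t2 k; rewrite wA ?inE.
by split=> // k l; rewrite !tnth_mktuple pv ?inE.
Qed.
End Grow.

Section GrowConj.
Variables (R : realType) (t : typeA) (n : nat) (Omega : 'M[R[i]]_n).
Local Notation C := R[i].
Local Notation V := 'cV[C]_n.
Local Notation eps := (eps R t).
Local Notation om := (omega Omega).
Local Notation ga := (gamma Omega).
Local Notation conj_sign := (@conj_sign R t n).
Hypothesis compO : compatible t Omega.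
Variable F : chain R n.
Hypothesis XF : X F.

(** The last clause records that a pair is created when its smaller index is the
    smallest untreated one. It controls the treated part of gamma (v k) in
    [conj_step]. *)
Definition conj_state (vw : ('I_n -> V) * 'S_n) (D : {set 'I_n}) :=
  let: (v, w) := vw in
  [/\ adapted F v, forall k, w (w k) = k, forall k, k \notin D -> w k = k,
      t = TypeA2 -> forall k, k \in D -> w k != k &
      (forall k, k \in D -> ga (v k) = conj_sign w k *: v (w k)) /\
      (forall i k, i \in D -> k \notin D -> (i < k)%N \/ (w i < k)%N)].

(** After subtraction of the components of gamma (v k) whose partner lies below
    [k], the remaining treated components sit below [k], so gamma of the new
    vector has its leading term at an untreated index [m]. If [m > k], the image
    replaces [v m]. If [m = k], the new vector is fixed by gamma up to a scalar
    and up to lower terms, and averaging over gamma gives a fixed vector. *)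
Lemma conj_step vw D k :
  conj_state vw D -> k \notin D -> (forall j : 'I_n, (j < k)%N -> j \in D) ->
  exists vw' D', conj_state vw' D' /\ D \proper D'.
Proof.
case: vw => v w [av ww wf wA [gv low]] kD kmin.
have wD j : j \in D -> w j \in D.
  move=> jD; apply: contraT => wj; have := wf _ wj; rewrite ww => E.
  by move: wj; rewrite -E jD.
have neqD i j : i \in D -> j \notin D -> (i == j) = false.
  by move=> iD jD; apply: contraNF jD => /eqP<-.
have kle j : j \notin D -> (k <= j)%N.
  by apply: contraR; rewrite -ltnNge => /kmin.
have kn : (k <= n)%N by rewrite ltnW.
pose b := mktuple v; have bv : basis_of fullv b by exact: (adapted_basis XF av).
have mem_low x m := mem_adapted XF av (p := m) x.
have eexp x : x = \sum_j coord b j x *: v j := adapted_expand XF av x.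
have cv j l : coord b j (v l) = (j == l)%:R := coord_adapted XF av j l.
have vlow (j : 'I_n) m : (j < m <= n)%N -> v j \in F (inord m).
  by move=> jm; have [+ _] := av j; apply: (flag_up XF).
(* gamma y lies in F_k because every index in the sum has its partner below k;
   subtracting [eps *: ga y] from [v k] subtracts y from its image. *)
pose y := \sum_(j | (j \in D) && (w j < k)%N) coord b j (ga (v k)) *: v j.
have gy : ga y \in F (inord k).
  rewrite /y (big_morph ga (gaD Omega) (ga0 Omega));
    apply: memv_suml => j /andP[jD jk].
  by rewrite gaZ (gv j) // scalerA; apply/memvZ/vlow; rewrite jk kn.
pose x := v k - eps *: ga y; pose z := ga (v k) - y.
have gx : ga x = z.
  by rewrite /x -scaleNr gaD gaZ rmorphN /= conj_eps (gaK compO) scalerA mulNr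
     epsM scaleN1r.
have gz : ga z = eps *: x by rewrite -gx (gaK compO).
have ax : x \in F (inord k.+1) /\ x \notin F (inord k).
  by rewrite /x -scaleNr; apply: (adaptedD XF) => //; apply: memvZ.
have xk : coord b k x != 0.
  have [x1 x2] := ax; apply: contraNneq x2 => x0; apply/mem_low => // j.
  rewrite leq_eqVlt => /predU1P[/val_inj <- //|kj].
  by move/mem_low: x1; apply; rewrite ?ltn_ord.
pose c j := coord b j z.
have c0 j : j \in D -> (w j < k)%N -> c j = 0.
  move=> jD jk; rewrite /c linearB linear_sum (bigD1 j) ?jD //= big1.
    by rewrite linearZ /= cv eqxx mulr1 addr0 subrr.
  by move=> l /andP[_ lj]; rewrite linearZ /= cv eq_sym (negbTE lj) mulr0.
have cD j : j \in D -> (k <= j)%N -> c j = 0.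
  by move=> jD kj; apply: c0 => //; case: (low _ _ jD kD) => //;
    rewrite ltnNge kj.
clearbody x z.
have small_ga r : r \in F (inord k) -> coord b k (ga r) = 0.
  move/mem_low => r0; rewrite (eexp r) ga_sum linear_sum big1 // => j _.
  have [/r0 ->|jk] := leqP k j; rewrite // ?scale0r ?ga0 ?linear0 //.
  by rewrite gaZ gv ?kmin // !linearZ /= cv eq_sym neqD ?mulr0 // wD // kmin.
pose Q := [pred m : 'I_n | (m \notin D) && (c m != 0)].
have [m0 Qm0] : exists m, Q m.
  apply: contrapT => nQ; move/eqP: xk; apply.
  have zk : z \in F (inord k).
    apply/mem_low => // j kj; have [jD|jD] := boolP (j \in D); first exact: cD.
    by apply: contrapT => l0; apply: nQ; exists j; rewrite /= jD; apply/eqP.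
  have -> : x = eps *: ga z by rewrite gz scalerA epsM scale1r.
  by rewrite linearZ /= small_ga // mulr0.
case: (@arg_maxnP _ m0 Q val Qm0) => m /andP[mD cm] mmax.
have km := kle _ mD.
have az : z \in F (inord m.+1) /\ z \notin F (inord m).
  split; last by apply/mem_low => [|/(_ m (leqnn _))/eqP];
    [rewrite ltnW|exact/negP].
  apply/mem_low => // j mj; have [jD|jD] := boolP (j \in D).
    by apply: cD => //; apply: leq_trans km (ltnW mj).
  apply: contrapT => /eqP j0; have := mmax j; rewrite /= jD j0 => /(_ isT).
  by rewrite leqNgt mj.
have [mk|mk] := eqVneq m k.
- subst m.
  pose d := c k / coord b k x; pose r := z - d *: x.
  have zE : z = d *: x + r by rewrite addrC subrK.
  have r_low : r \in F (inord k).
    apply/mem_low => // j; rewrite leq_eqVlt => /predU1P[/val_inj <-|kj].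
      by rewrite linearB linearZ /= mulfVK // subrr.
    have [/mem_low x1 _] := ax; have [/mem_low z1 _] := az.
    by rewrite linearB linearZ /= x1 ?z1 // ?ltn_ord // mulr0 subrr.
  have dd : conjc d * d = eps.
    have : coord b k (eps *: x) = conjc d * d * coord b k x.
      rewrite -gz {1}zE gaD gaZ gx linearD linearZ /= small_ga // addr0.
      by rewrite zE linearD linearZ /= (mem_low _ _ _ r_low) // addr0 mulrA.
    by rewrite linearZ /= => /(mulIf xk).
  (* In type A2 the number d would satisfy conj(d) d = -1. *)
  have t1 : t = TypeA1.
    case E : t => //; have := mul_conjC_ge0 d; rewrite mulrC.
    by rewrite [_ * _]dd /Defs.eps E oppr_ge0 ler10.
  have eps1 : eps = 1 by rewrite /Defs.eps t1.
  (* The average x + gamma x has k-component (1 + d) times that of x; when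
     d = -1, x is multiplied by 'i first. *)
  have [u au gu] :
      exists2 u, u \in F (inord k.+1) /\ u \notin F (inord k) & ga u = u.
    have [dm|dm] := eqVneq d (-1).
      exists ('i *: (x - z)); last first.
        have ci : conjc ('i : C) = - 'i by exact: conjCi.
        have c1 : conjc (-1 : C) = -1 by rewrite rmorphN rmorph1.
        rewrite gaZ ci -[- z]scaleN1r gaD gaZ c1 gx gz eps1 scale1r.
        by rewrite !scaleN1r scaleNr -scalerN opprB.
      apply: adaptedZ; first exact: neq0Ci.
      have -> : x - z = 2 *: x - r.
        by rewrite zE dm scaleN1r opprD opprK addrA scaler_nat mulr2n.
      apply: (adaptedD XF); last by rewrite memvN.
      by apply: adaptedZ; rewrite ?pnatr_eq0.
    exists (x + z); last by rewrite gaD gx gz eps1 scale1r addrC.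
    have -> : x + z = (1 + d) *: x + r by rewrite scalerDl scale1r -addrA -zE.
    apply: (adaptedD XF) => //.
    by apply: adaptedZ; rewrite // addrC -[1]opprK subr_eq0.
  pose v' j := if j == k then u else v j.
  exists (v', w), (k |: D); split; last first.
    by rewrite properE finset.subsetUr; apply/subsetPn; exists k;
      rewrite // !inE eqxx.
  split=> //.
  + by move=> j; rewrite /v'; case: ifPn => [/eqP ->|].
  + by move=> j; rewrite !inE negb_or => /andP[_ /wf].
  + by rewrite t1.
  + split=> [j|i j].
      rewrite !inE => /predU1P[->|jD].
        by rewrite wf // /v' eqxx gu /conj_sign wf // leqnn eps1 scale1r.
      by rewrite /v' !neqD ?gv ?wD.
    rewrite !inE negb_or => /predU1P[->|iD] /andP[jk jD]; last exact: low.
    by left; rewrite ltn_neqAle eq_sym jk kle.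
- have {}km : (k < m)%N by rewrite ltn_neqAle eq_sym mk.
  pose w' := (tperm k m * w)%g.
  have w'k : w' k = m by rewrite permM tpermL wf.
  have w'm : w' m = k by rewrite permM tpermR wf.
  have w'N j : j != k -> j != m -> w' j = w j.
    by move=> jk jm; rewrite permM tpermD // eq_sym.
  pose v' j := if j == k then x else if j == m then eps *: z else v j.
  have v'k : v' k = x by rewrite /v' eqxx.
  have v'm : v' m = eps *: z by rewrite /v' eqxx (negbTE mk).
  have v'D j : j \in D -> v' j = v j by move=> jD; rewrite /v' !neqD.
  exists (v', w'), (k |: (m |: D)); split; last first.
    rewrite properE finset.setUA finset.subsetUr; apply/subsetPn.
    by exists k; rewrite // !inE eqxx.
  split.
  + move=> j; rewrite /v'; case: ifPn => [/eqP -> //|_];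
    case: ifPn => [/eqP ->|_ //].
    by apply: adaptedZ => //; exact: eps_neq0.
  + move=> j; have [->|jk] := eqVneq j k; first by rewrite w'k w'm.
    have [->|jm] := eqVneq j m; first by rewrite w'm w'k.
    rewrite (w'N j) // w'N ?ww //; apply: contraNneq (kD).
      by move=> wjk; move: jk; rewrite -[j]ww wjk wf ?eqxx.
    by move=> wjm; move: jm; rewrite -[j]ww wjm wf ?eqxx.
  + by move=> j; rewrite !inE !negb_or => /and3P[jk jm jD]; rewrite w'N ?wf.
  + move=> t2 j; rewrite !inE => /or3P[/eqP ->|/eqP ->|jD];
    rewrite ?w'k ?w'm //.
      by rewrite eq_sym.
    by rewrite w'N ?wA //; apply/negbT/neqD.
  + split=> [j|i j].
    -- rewrite !inE => /or3P[/eqP ->|/eqP ->|jD].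
       * by rewrite v'k /conj_sign w'k v'm (ltnW km) scalerA epsM scale1r.
       * rewrite v'm /conj_sign w'm v'k leqNgt km scale1r gaZ conj_eps gz.
         by rewrite scalerA epsM scale1r.
       * by rewrite v'D // gv // /conj_sign w'N ?v'D ?wD //; apply/negbT/neqD.
    -- rewrite !inE !negb_or => iD /and3P[jk jm jD].
       have kj : (k < j)%N by rewrite ltn_neqAle eq_sym jk kle.
       case/or3P: iD => [/eqP ->|/eqP ->|iD]; [by left|by right; rewrite w'm|].
       by rewrite w'N; [exact: low|exact/negbT/neqD..].
Qed.

Lemma exists_conj : exists w v,
  [/\ involutions t w, w_conjugate t Omega w v & flag_of v = F].
Proof.
have [v0 av0] := exists_adapted XF.
have [|[v w] [av ww _ wA [gv _]]] :=
    @exhaust n _ conj_state (v0, 1%g) _ conj_step.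
  split=> // [k|k _|_ k|]; rewrite ?inE ?perm1 //.
  by split=> [k|i k]; rewrite inE.
have [bv Fv] := adapted_mktuple XF av.
exists w, (mktuple v); split=> //; first by split=> // t2 k; rewrite wA ?inE.
split=> // k; rewrite !tnth_mktuple gv ?inE // /conj_sign.
by case: ifP; rewrite ?scale1r.
Qed.
End GrowConj.

(** * Flags that are both dual and conjugate *)
Section Both.
Variables (R : realType) (t : typeA) (n : nat) (Omega : 'M[R[i]]_n).
Local Notation C := R[i].
Local Notation V := 'cV[C]_n.
Local Notation eps := (eps R t).
Local Notation om := (omega Omega).
Local Notation ga := (gamma Omega).
Local Notation hm := (hform Omega).
Local Notation conj_sign := (@conj_sign R t n).
Hypothesis compO : compatible t Omega.

(** Each orthogonality condition cuts the dimension by at most one. *)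
Lemma exists_orth_vec (s : seq V) (U : {vspace V}) : (size s < \dim U)%N ->
  exists x, [/\ x \in U, x != 0 & forall y, y \in s -> hm y x = 0].
Proof.
elim: s U => [|y s IH] U /= sU.
  exists (vpick U); rewrite memv_pick vpick0 -dimv_eq0 -lt0n sU.
  by split.
pose f : {linear V -> C^o} := HB.pack (fun x : V => hm y x : C^o)
  (GRing.isLinear.Build C V C^o *:%R _ (omega_is_linearr Omega (ga y))).
have [|x [xU x0 xs]] := IH (U :&: lker (linfun f))%VS.
  have d1 : (\dim (linfun f @: U) <= 1)%N.
    by rewrite (leq_trans (dimvS (subvf _))) // dimvf.
  rewrite -ltnS; move: sU; rewrite -(limg_ker_dim (linfun f) U) => sU.
  by apply: leq_trans sU _; rewrite -[X in (_ <= X)%N]addn1 leq_add2l.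
move: xU; rewrite memv_cap memv_ker lfunE => /andP[xU /eqP yx].
exists x; split=> // e; rewrite inE => /predU1P[->|]; [exact: yx|exact: xs].
Qed.

Lemma exists_unit_orth (s : seq V) (U : {vspace V}) : (size s < \dim U)%N ->
  exists x, [/\ x \in U, hm x x = 1 & forall y, y \in s -> hm y x = 0].
Proof.
move=> /exists_orth_vec[x [xU x0 ox]].
have xx : hm x x != 0 by apply: contraNneq x0 => /(hm_eq0 compO) ->.
pose c := sqrtC (hm x x).
have cc : conjc c = c.
  by apply: (@geC0_conj _ c); rewrite sqrtC_ge0; exact: (hm_ge0 compO).
exists (c^-1 *: x); split=> [||y ys]; first exact: memvZ; last first.
  by rewrite hmZr ox // mulr0.
have c2 : hm x x = c * c by rewrite -expr2 sqrtCK.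
by rewrite hmZr hmZl conjc_inv cc c2 mulKf ?mulVf // sqrtC_eq0.
Qed.

Section Orthonormal.
Variable F : chain R n.
Hypothesis XF : X F.

Lemma exists_orthonormal : exists u,
  [/\ adapted F u, forall (k : 'I_n) y, y \in F (inord k) -> hm y (u k) = 0 &
      forall k l, hm (u k) (u l) = (k == l)%:R].
Proof.
have [dF _] := XF.
have /choice[u uP] (k : 'I_n) : exists x,
    [/\ x \in F (inord k.+1), x \notin F (inord k),
        forall y, y \in F (inord k) -> hm y x = 0 & hm x x = 1].
  have [|x [xk x1 ox]] :=
    @exists_unit_orth (vbasis (F (inord k))) (F (inord k.+1)).
    by rewrite size_tuple !dF inordn inordSn.
  have oF y : y \in F (inord k) -> hm y x = 0.
    move=> yk; rewrite (hm_sym compO) (coord_vbasis yk) /hform om_sumr big1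
      ?conjc0 //.
    move=> j _; rewrite omZr -/(hm x _) (hm_sym compO) ox ?conjc0 ?mulr0 //.
    by rewrite mem_nth // size_tuple.
  exists x; split=> //; apply/negP => /oF /eqP.
  by rewrite x1 oner_eq0.
have o (k : 'I_n) y : y \in F (inord k) -> hm y (u k) = 0.
  by move: y; case: (uP k).
exists u; split=> // [k|k l]; first by case: (uP k).
have uk (p q : 'I_n) : (p < q)%N -> hm (u p) (u q) = 0.
  move=> pq; apply: o; have [+ _ _ _] := uP p.
  by apply: (flag_up XF); rewrite pq ltnW.
case: (ltngtP k l) => [kl|lk|/val_inj ->]; last by rewrite eqxx; case: (uP l).
  by rewrite uk //; case: eqP kl => // ->; rewrite ltnn.
by rewrite (hm_sym compO) uk // conjc0; case: eqP lk => // ->; rewrite ltnn.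
Qed.
End Orthonormal.

(** Each [v k] is up to sign gamma of its partner, so omega(v_k, v_l) is up to
    sign h(v_(w k), v_l). *)
Lemma orthonormal_conj_dual (w : 'S_n) (v : n.-tuple V) :
  involutions t w -> w_conjugate t Omega w v ->
  (forall k l, hm (tnth v k) (tnth v l) = (k == l)%:R) ->
  w_dual t Omega w v.
Proof.
move=> [ww wA] cv ov; have [bv _] := cv; split=> // k l.
have vk : tnth v k = conj_sign w (w k) *: ga (tnth v (w k)).
  by rewrite (ga_conj cv) ww scalerA /conj_sign; case: ifP;
    rewrite ?epsM ?mulr1 scale1r.
rewrite vk omZl -/(hm _ _) ov /conj_sign ww; case: eqP => [<-|_];
  last by rewrite mulr0.
rewrite mulr1; case: ltngtP => // /val_inj wk; rewrite /Defs.eps.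
by case E : t => //; have := wA E k; rewrite wk eqxx.
Qed.

Section Decomposition.
Variables (w : 'S_n) (v v' : n.-tuple V).
Hypothesis iw : involutions t w.
Hypotheses (dv : w_dual t Omega w v) (cv : w_conjugate t Omega w v').
Hypothesis vv' : flag_of v' = flag_of v.
Let F := flag_of v.
Let ww : forall k, w (w k) = k. Proof. by case: iw. Qed.
Let bv : basis_of fullv v. Proof. by case: dv. Qed.
Let bv' : basis_of fullv v'. Proof. by case: cv. Qed.

(** The direct sum of [dim_gamma_orth] fills [F p]: when both bases belong to the
    same w, its dimension is that of [F p]. *)
Lemma orth_decomposition (p q : 'I_n.+1) x : x \in F p ->
  exists y z, [/\ x = y + z, y \in (gammav Omega (F q) :&: F p)%VS
    & z \in (orthv Omega (F q) :&: F p)%VS].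
Proof.
suff E : ((gammav Omega (F q) :&: F p) + (orthv Omega (F q) :&: F p) = F p)%VS.
  by rewrite -{1}E => /memv_addP[y yA [z zB ->]]; exists y, z.
apply/eqP; rewrite eqEdim subv_add !capvSr /=.
by rewrite (dim_gamma_orth compO ww ww dv cv vv') (card_flag dv q).
Qed.

(** Decompose [u k] in [F k.+1] with respect to [F q]. For [q = w k] the first
    component has no coordinate at [k] in the conjugate basis, so it lies in
    [F k], to which [u k] is orthogonal: it vanishes, and gamma (u k) is
    orthogonal to [F (w k)]. For [q = (w k).+1] the second component has no
    coordinate at [k] in the dual basis and vanishes likewise, so gamma (u k)
    lies in [F (w k).+1]. *)
Lemma gamma_orthonormal (u : 'I_n -> V) (k : 'I_n) : adapted F u ->
  (forall (k : 'I_n) y, y \in F (inord k) -> hm y (u k) = 0) ->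
  exists c, ga (u k) = c *: u (w k).
Proof.
move=> au ou; have XF : X F by exact: X_flag_of.
have [uk uk'] := au k.
have hm_yz q y z : y \in (gammav Omega (F q) :&: F (inord k.+1))%VS ->
    z \in (orthv Omega (F q) :&: F (inord k.+1))%VS -> hm y z = 0.
  rewrite !memv_cap => /andP[/memv_gammav[e eF ->] _] /andP[/memv_orthv zo _].
  by rewrite /hform (gaK compO) omZl (om_sym compO) zo // !mulr0.
have o e : e \in F (inord (w k)) -> om e (u k) = 0.
  have [y [z [uE yA zB]]] := orth_decomposition (inord (w k)) uk.
  have yk : y \in F (inord k).
    move: yA; rewrite memv_cap => /andP[+ +].
    rewrite /F -vv' => /(mem_gamma_flag compO ww cv) c0 /(mem_flag_of bv') c1;
      apply/(mem_flag_of bv') => j.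
    rewrite inordn leq_eqVlt => /predU1P[/val_inj <-|kj].
      by apply: c0; rewrite inordn.
    by apply: c1; rewrite inordSn.
  have : hm y (y + z) = 0 by rewrite -uE ou.
  rewrite hmDr (hm_yz _ _ _ yA zB) addr0 => /(hm_eq0 compO) y0.
  move: zB; rewrite memv_cap uE y0 add0r => /andP[/memv_orthv zo _] eF.
  by rewrite (om_sym compO) zo // mulr0.
have gu : ga (u k) \in F (inord (w k).+1).
  have [y [z [uE yA zB]]] := orth_decomposition (inord (w k).+1) uk.
  have zk : z \in F (inord k).
    move: zB; rewrite memv_cap => /andP[].
    move=> /(mem_orth_flag ww dv) c0 /(mem_flag_of bv) c1.
    apply/(mem_flag_of bv) => j.
    rewrite inordn leq_eqVlt => /predU1P[/val_inj <-|kj].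
      by apply: c0; rewrite inordSn.
    by apply: c1; rewrite inordSn.
  have : hm z (y + z) = 0 by rewrite -uE ou.
  rewrite hmDr (hm_sym compO) (hm_yz _ _ _ yA zB) conjc0 add0r.
  move=> /(hm_eq0 compO) z0.
  move: yA; rewrite memv_cap uE z0 addr0 => /andP[/memv_gammav[e eF ->] _].
  by rewrite (gaK compO); exact: memvZ.
pose c := coord (mktuple u) (w k) (ga (u k)); exists c.
pose r := ga (u k) - c *: u (w k).
have rF : r \in F (inord (w k)).
  apply/(mem_adapted XF au); first by rewrite ltnW.
  move=> j; rewrite leq_eqVlt linearB linearZ /= (coord_adapted XF au).
  case/predU1P => [/val_inj <-|kj]; first by rewrite eqxx mulr1 subrr.
  have -> : coord (mktuple u) j (ga (u k)) = 0.
    by move/(mem_adapted XF au): gu; apply; rewrite ?ltn_ord.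
  by case: eqP kj => [->|_]; rewrite ?ltnn // mulr0 subr0.
apply/eqP; rewrite -subr_eq0; apply/eqP/(hm_eq0 compO).
rewrite -/r {2}/r hmDr -scaleNr hmZr ou // mulr0 addr0 /hform (om_ga compO).
by rewrite o // conjc0.
Qed.

(** The scalars c in gamma (u k) = c_k u_(w k) have modulus one and satisfy
    conj(c_k) c_(w k) = eps. Inside a pair, the vector of larger index absorbs
    the scalar; at a fixed point of w, multiplying u_k by a square root of c_k
    makes it fixed by gamma. *)
Lemma dual_conj_basis : exists u : n.-tuple V,
  [/\ w_dual t Omega w u, w_conjugate t Omega w u & flag_of u = F].
Proof.
have XF : X F by exact: X_flag_of.
have [u [au ou uu]] := exists_orthonormal XF.
have /choice[c gc] (k : 'I_n) := gamma_orthonormal k au ou.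
have unz k : u k != 0.
  by have := uu k k; rewrite eqxx; case: eqP => // ->;
    rewrite hm0r => /esym/eqP; rewrite oner_eq0.
have cc k : conjc (c k) * c k = 1.
  have := hm_ga compO (u k) (u k).
  by rewrite gc hmZl hmZr !uu !eqxx mulr1 conjc1.
have cw k : conjc (c k) * c (w k) = eps.
  have := gaK compO (u k); rewrite gc gaZ gc ww scalerA => /eqP.
  rewrite -subr_eq0 -scalerBl scaler_eq0 (negbTE (unz k)) orbF subr_eq0.
  by move/eqP.
pose s (k : 'I_n) : C := if (k < w k)%N then 1 else
  if (w k < k)%N then eps * c (w k) else sqrtC (c k).
have ss k : conjc (s k) * s k = 1.
  rewrite /s; case: ltngtP => _; first by rewrite conjc1 mulr1.
    by rewrite rmorphM /= conj_eps mulrACA epsM mul1r cc.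
  set d := sqrtC _.
  have d1 : (conjc d * d) ^+ 2 = 1.
    rewrite exprMn -rmorphXn /= sqrtCK; exact: cc.
  have d0 : 0 <= conjc d * d by rewrite mulrC; exact: mul_conjC_ge0.
  by apply/eqP; rewrite -(@eqrXn2 _ 2) ?ler01 // d1 expr1n.
have s0 k : s k != 0.
  by have := ss k; case: eqP => // ->; rewrite mulr0 => /esym/eqP;
    rewrite oner_eq0.
pose b := [tuple s k *: u k | k < n].
have ab : adapted F (tnth b).
  by move=> k; rewrite tnth_mktuple; apply: adaptedZ.
have [bb Fb] := flag_of_adapted XF ab.
have cb : w_conjugate t Omega w b.
{ split=> // k; rewrite !tnth_mktuple gaZ gc /s ww.
  case: ltngtP => [kw|wk|/val_inj wk].
  - by rewrite conjc1 scale1r scalerA mulrA epsM mul1r.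
  - rewrite rmorphM /= conj_eps scalerA -mulrA.
    by have := cw (w k); rewrite ww => ->; rewrite epsM ?scale1r.
  - have -> : eps = 1.
      by rewrite /Defs.eps; case E : t => //; case: iw => _ /(_ E k);
        rewrite -wk eqxx.
    rewrite scale1r scalerA -!wk; congr (_ *: _).
    have := ss k; rewrite /s -wk ltnn; move: (sqrtCK (c k));
      set d := sqrtC _ => <-.
    by rewrite expr2 mulrA => ->; rewrite mul1r. }
exists b; split=> //; apply: orthonormal_conj_dual => // k l.
rewrite !tnth_mktuple hmZl hmZr uu; case: eqP => [->|]; last by rewrite !mulr0.
by rewrite mulr1 ss.
Qed.
End Decomposition.
End Both.

(** * Bases that are both dual and conjugate *)
Section Existence.
Variables (R : realType) (t : typeA) (n : nat) (Omega : 'M[R[i]]_n).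
Local Notation C := R[i].
Local Notation V := 'cV[C]_n.
Local Notation eps := (eps R t).
Local Notation om := (omega Omega).
Local Notation ga := (gamma Omega).
Local Notation hm := (hform Omega).
Local Notation conj_sign := (@conj_sign R t n).
Hypothesis compO : compatible t Omega.

Lemma orthonormal_basis (v : n.-tuple V) :
  (forall k l, hm (tnth v k) (tnth v l) = (k == l)%:R) -> basis_of fullv v.
Proof.
move=> ov; rewrite basisEfree subvf dim_cV size_tuple leqnn !andbT.
apply/freeP => c c0 k; have : hm (tnth v k) 0 = 0 by rewrite hm0r.
rewrite -c0 /hform om_sumr (bigD1 k) //= big1 => [|l lk].
  by rewrite omZr -(tnth_nth 0) -/(hm _ _) ov eqxx mulr1 addr0.
by rewrite omZr -(tnth_nth 0) -/(hm _ _) ov eq_sym (negbTE lk) mulr0.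
Qed.

(** These two numbers are complex conjugates, of modulus 1/sqrt 2 and with
    squares i/2 and -i/2. Combining two vectors exchanged by gamma with them
    gives a vector fixed by gamma, and combining two vectors fixed by gamma gives
    two vectors exchanged by gamma. *)
Definition halfp : C := (1 + 'i) / 2.
Definition halfm : C := (1 - 'i) / 2.

Lemma conj_halfp : conjc halfp = halfm.
Proof.
have i2 : conjc (2^-1 : C) = 2^-1 by rewrite conjc_inv conjc_nat.
have ci : conjc ('i : C) = - 'i by exact: conjCi.
by rewrite /halfp rmorphM rmorphD rmorph1; congr ((1 + _) * _).
Qed.

Lemma conj_halfm : conjc halfm = halfp.
Proof. by rewrite -conj_halfp conjcK. Qed.

Lemma half_norm : halfp * halfm + halfm * halfp = 1.
Proof.
have -> : halfp * halfm + halfm * halfp = (1 - 'i ^+ 2) / 2.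
  by rewrite /halfp /halfm; field.
by rewrite sqrCi opprK -[1 + 1]/(2%:R) divff ?pnatr_eq0.
Qed.

Lemma half_sqr : halfp * halfp + halfm * halfm = 0.
Proof.
have -> : halfp * halfp + halfm * halfm = (1 + 'i ^+ 2) / 2.
  by rewrite /halfp /halfm; field.
by rewrite sqrCi subrr mul0r.
Qed.

(** The mixed products enter with the coefficient halfp^2 + halfm^2 = 0. *)
Lemma half_combination_orthonormal (I : finType) (f g : I -> V) :
  (forall i j, hm (f i) (f j) = (i == j)%:R) ->
  (forall i j, hm (g i) (g j) = (i == j)%:R) ->
  (forall i j, hm (f i) (g j) = hm (g i) (f j)) ->
  forall i j, hm (halfm *: f i + halfp *: g i) (halfm *: f j + halfp *: g j) =
              (i == j)%:R.
Proof.
move=> of_ og fg i j; rewrite (hmDr _ _ (halfm *: f j)) !hmZr.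
have hmDl x y z : hm (x + y) z = hm x z + hm y z by rewrite /hform gaD omDl.
rewrite !hmDl !hmZl !conj_halfp !conj_halfm of_ og fg.
set x := hm _ _; set d := _%:R.
have -> : halfm * (halfp * d + halfm * x) + halfp * (halfp * x + halfm * d) =
  (halfp * halfm + halfm * halfp) * d + (halfp * halfp + halfm * halfm) * x.
  by ring.
by rewrite half_norm half_sqr mul1r mul0r addr0.
Qed.

(** Apply [half_combination_orthonormal] to the canonical basis and its image
    under gamma, which gamma exchanges; the mixed products agree because [Omega]
    is real. *)
Lemma exists_real_orthonormal : t = TypeA1 -> exists f : 'I_n -> V,
  (forall i j, hm (f i) (f j) = (i == j)%:R) /\ forall i, ga (f i) = f i.
Proof.
move=> t1; have e1 : eps = 1 by rewrite /Defs.eps t1.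
pose e (i : 'I_n) : V := delta_mx i 0.
have ee i j : hm (e i) (e j) = (i == j)%:R.
  rewrite (hmE compO) (bigD1 i) //= big1 => [|k ki]; rewrite !mxE !eqxx.
    by rewrite rmorph1 mul1r addr0 andbT.
  by rewrite (negbTE ki) rmorph0 mul0r.
have omE i j : om (e i) (e j) = Omega i j.
  by rewrite /omega trmx_delta -rowE -colE !mxE.
exists (fun i => halfm *: e i + halfp *: ga (e i)); split=> [|i].
  apply: half_combination_orthonormal => // i j;
    first by rewrite (hm_ga compO) ee rmorph_nat.
  rewrite /hform (om_ga compO) (gaK compO) omZl e1 mul1r omE.
  by case: compO => _ Oc _; rewrite -{2}Oc mxE.
by rewrite gaD !gaZ conj_halfp conj_halfm (gaK compO) e1 scale1r addrC.
Qed.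

(** Combining [f k] with [f (w k)] in the same way makes gamma exchange the two
    vectors of each pair. *)
Lemma exists_orthonormal_conj_A1 (w : 'S_n) : involutions t w -> t = TypeA1 ->
  exists2 v : 'I_n -> V, forall k l, hm (v k) (v l) = (k == l)%:R &
    forall k, ga (v k) = conj_sign w k *: v (w k).
Proof.
move=> [ww _] t1; have [f [of_ gf]] := exists_real_orthonormal t1.
exists (fun k => halfm *: f k + halfp *: f (w k)) => [|k].
  apply: half_combination_orthonormal => // i j;
    first by rewrite of_ (inj_eq (@perm_inj _ w)).
  by rewrite !of_ -(inj_eq (@perm_inj _ w)) ww.
rewrite gaD !gaZ conj_halfp conj_halfm !gf ww /conj_sign /Defs.eps t1 if_same
  scale1r.
exact: addrC.
Qed.

(** Add pairs one by one: choose a unit vector x orthogonal to the previous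
    vectors. Their span is stable under gamma, so gamma x is orthogonal to it as
    well, and h(x, gamma x) = 0 because omega is alternating. *)
Lemma exists_orthonormal_conj_A2 (w : 'S_n) : involutions t w -> t = TypeA2 ->
  exists2 v : 'I_n -> V, forall k l, hm (v k) (v l) = (k == l)%:R &
    forall k, ga (v k) = conj_sign w k *: v (w k).
Proof.
move=> [ww wA] t2.
pose P (v : 'I_n -> V) (D : {set 'I_n}) := [/\ forall k, k \in D -> w k \in D,
  forall k l, k \in D -> l \in D -> hm (v k) (v l) = (k == l)%:R &
  forall k, k \in D -> ga (v k) = conj_sign w k *: v (w k)].
have [||v [_ ov gv]] := @exhaust n _ P (fun=> 0).
- by split=> k; rewrite ?inE // => l; rewrite inE.
- move=> v D k [wD ov gv] kD kmin.
  have wkD : w k \notin D by apply: contraNN kD => /wD; rewrite ww.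
  have kw : (k < w k)%N.
    rewrite ltn_neqAle eq_sym wA //=; apply: contraR wkD; rewrite -ltnNge.
    exact: kmin.
  have [|x [_ xx ox]] := @exists_unit_orth _ _ _ _ compO
    [seq v i | i <- enum D] fullv.
    rewrite dim_cV size_map -cardE -[X in (_ < X)%N]card_ord -cardsT.
    by apply: proper_card; rewrite finset.properEneq finset.subsetT andbT;
      apply: contraNneq kD => ->.
  have oD i : i \in D -> hm (v i) x = 0.
    by move=> iD; rewrite ox ?map_f ?mem_enum.
  have oD' i : i \in D -> om (v i) x = 0.
    move=> iD; have := gv _ (wD _ iD); rewrite ww => /(congr1 (om^~ x)).
    rewrite -/(hm _ _) oD ?wD // omZl => /esym/eqP; rewrite mulf_eq0.
    by rewrite (negbTE (conj_sign_neq0 _ _ _ _)) => /eqP.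
  pose y := eps *: ga x.
  have oy z : om z x = 0 -> hm z y = 0.
    by move=> zx; rewrite hmZr /hform (om_ga compO) zx conjc0 mulr0.
  have yy : hm y y = 1.
    by rewrite hmZl hmZr conj_eps mulrA epsM mul1r (hm_ga compO) xx conjc1.
  have xy : hm x y = 0 by apply: oy; exact: (om_alt compO).
  pose v' j := if j == k then x else if j == w k then y else v j.
  have v'k : v' k = x by rewrite /v' eqxx.
  have v'w : v' (w k) = y by rewrite /v' eqxx (negbTE (wA t2 k)).
  have v'D j : j \in D -> v' j = v j.
    rewrite /v' => jD; case: eqP => [jk|_]; first by rewrite -jk jD in kD.
    by case: eqP => // jw; rewrite -jw jD in wkD.
  exists v', (k |: (w k |: D)); split; last first.
    rewrite properE finset.setUA finset.subsetUr; apply/subsetPn.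
    by exists k; rewrite // !inE eqxx.
  have o2 i j : i \in (k |: (w k |: D)) -> j \in (k |: (w k |: D)) ->
      (i == j) || (hm (v' i) (v' j) == 0).
    { rewrite !inE => /or3P[/eqP->|/eqP->|iD] /or3P[/eqP->|/eqP->|jD];
      rewrite ?eqxx // ?v'k ?v'w ?v'D //; apply/orP.
    + by right; rewrite xy.
    + by right; rewrite (hm_sym compO) oD // conjc0.
    + by right; rewrite (hm_sym compO) xy conjc0.
    + by right; rewrite (hm_sym compO) oy ?oD' // conjc0.
    + by right; rewrite oD.
    + by right; rewrite oy // oD'.
    + by have [|ij] := eqVneq i j; [left|right; rewrite ov // (negbTE ij)]. }
  split=> [j|i j iD jD|j].
  + by rewrite !inE => /or3P[/eqP->|/eqP->|/wD ->]; rewrite ?ww ?eqxx ?orbT.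
  + have := o2 i j iD jD; case: eqP => [<- _|_ /eqP //].
    move: iD; rewrite !inE => /or3P[/eqP->|/eqP->|iD];
      rewrite ?v'k ?v'w ?v'D //.
    by rewrite ov ?eqxx.
  + rewrite !inE => /or3P[/eqP->|/eqP->|jD].
    * by rewrite v'k v'w /conj_sign (ltnW kw) scalerA epsM scale1r.
    * rewrite v'w /conj_sign ww v'k leqNgt kw scale1r gaZ conj_eps (gaK compO).
      by rewrite scalerA epsM scale1r.
    * by rewrite !v'D ?gv ?wD.
- by exists v => [k l|k]; rewrite ?ov ?gv ?inE.
Qed.

Lemma exists_dual_conj (w : 'S_n) : involutions t w -> exists v : n.-tuple V,
  w_dual t Omega w v /\ w_conjugate t Omega w v.
Proof.
move=> iw; have [v ov gv] : exists2 v : 'I_n -> V,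
    forall k l, hm (v k) (v l) = (k == l)%:R &
    forall k, ga (v k) = conj_sign w k *: v (w k).
  have [E|E] : t = TypeA1 \/ t = TypeA2 by case: (t); [left|right].
    exact: exists_orthonormal_conj_A1.
  exact: exists_orthonormal_conj_A2.
have ob k l : hm (tnth (mktuple v) k) (tnth (mktuple v) l) = (k == l)%:R.
  by rewrite !tnth_mktuple.
have cv : w_conjugate t Omega w (mktuple v).
  split=> [|k]; first exact: orthonormal_basis.
  by rewrite !tnth_mktuple gv /conj_sign; case: ifP; rewrite ?scale1r.
by exists (mktuple v); split=> //; exact: orthonormal_conj_dual.
Qed.
End Existence.

(** * Orbits and Matsuki duality *)
Section Orbits.
Variables (R : realType) (t : typeA) (n : nat) (Omega : 'M[R[i]]_n).
Local Notation C := R[i].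
Local Notation V := 'cV[C]_n.
Local Notation om := (omega Omega).
Local Notation ga := (gamma Omega).
Local Notation act := Defs.act.
Implicit Types (v : n.-tuple V) (g : 'M[C]_n) (w : 'S_n).

Definition mulv g v : n.-tuple V := map_tuple (mulmx g) v.

Lemma flag_of_mulv g v : flag_of (mulv g v) = act g (flag_of v).
Proof.
apply/ffunP => k; rewrite !ffunE limg_span -map_take; congr (span _).
by apply: eq_map => x; rewrite lfunE.
Qed.

Lemma basis_mulv g v : g \in unitmx -> basis_of fullv v ->
  basis_of fullv (mulv g v).
Proof.
move=> gU bv; rewrite basisEdim size_tuple dim_cV leqnn andbT.
apply/subvP => x _; rewrite -(mulKVmx gU x) (basis_expand bv (_ *m x))
  mulmx_sumr.
apply: memv_suml => j _; rewrite -scalemxAr; apply/memvZ/memv_span.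
by apply: map_f; exact: mem_tnth.
Qed.

Lemma basis_change v v' : basis_of fullv v -> basis_of fullv v' ->
  exists2 g, g \in unitmx & mulv g v = v'.
Proof.
pose M (u : n.-tuple V) : 'M[C]_n := \matrix_(p, q) tnth u q p 0.
have colM (u : n.-tuple V) j : col j (M u) = tnth u j.
  by apply/matrixP => p q; rewrite !mxE ord1.
have M_unit (u : n.-tuple V) : basis_of fullv u -> M u \in unitmx.
  move=> bu; pose N : 'M[C]_n := \matrix_(p, q) coord u p (delta_mx q 0).
  suff /mulmx1_unit[] : M u *m N = 1%:M by [].
  apply/matrixP => p q; rewrite [RHS]mxE.
  have /(congr1 (fun x : V => x p 0)) := basis_expand bu (delta_mx q 0).
  rewrite !mxE summxE eqxx andbT => ->.
  by apply: eq_bigr => j _; rewrite !mxE mulrC.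
move=> /M_unit vU /M_unit v'U; exists (M v' *m invmx (M v)).
  by rewrite unitmx_mul v'U unitmx_inv.
apply: eq_from_tnth => k; rewrite tnth_map -!colM.
by rewrite !colE mulmxA mulmxKV.
Qed.

(** Used for K, for G^0 and for their intersection: the hypotheses say that H is
    exactly the set of base changes between members of B. *)
Lemma orbit_flags (H : set 'M[C]_n) (B : set (n.-tuple V)) :
  (forall v, B v -> basis_of fullv v) -> H `<=` GL (n := n) ->
  (forall g v, H g -> B v -> B (mulv g v)) ->
  (forall g v, GL g -> B v -> B (mulv g v) -> H g) ->
  forall v, B v -> [set flag_of u | u in B] = [set act g (flag_of v) | g in H].
Proof.
move=> Bb HU HB BH v Bv; apply/seteqP; split=> [_ [u Bu <-]|_ [g Hg <-]].
  have [g gU gv] := basis_change (Bb _ Bv) (Bb _ Bu).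
  exists g; last by rewrite -flag_of_mulv gv.
  by apply: (BH _ v) => //; rewrite gv.
by exists (mulv g v); [exact: HB|rewrite flag_of_mulv].
Qed.

Lemma K_dual w g v :
  K Omega g -> w_dual t Omega w v -> w_dual t Omega w (mulv g v).
Proof.
move=> [gU gO] [bv dv]; split=> [|k l]; first exact: basis_mulv.
by rewrite !tnth_map gO.
Qed.

Lemma dual_K w g v : GL g -> w_dual t Omega w v ->
  w_dual t Omega w (mulv g v) -> K Omega g.
Proof.
move=> gU [bv dv] [_ dgv]; split=> // x y.
rewrite (basis_expand bv x) (basis_expand bv y) !mulmx_sumr !om_suml.
apply: eq_bigr => k _; rewrite !om_sumr; apply: eq_bigr => l _.
by rewrite -!scalemxAr !omZl !omZr dv -dgv !tnth_map.
Qed.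

Lemma G0_conj w g v :
  G0 Omega g -> w_conjugate t Omega w v -> w_conjugate t Omega w (mulv g v).
Proof.
move=> [gU gO] [bv cv]; split=> [|k]; first exact: basis_mulv.
by rewrite !tnth_map gO cv; case: ifP; rewrite ?scalemxAr.
Qed.

Lemma conj_G0 w g v : GL g -> w_conjugate t Omega w v ->
  w_conjugate t Omega w (mulv g v) -> G0 Omega g.
Proof.
move=> gU cv cgv; have [bv _] := cv; split=> // x.
rewrite (basis_expand bv x) !ga_sum !mulmx_sumr ga_sum.
apply: eq_bigr => k _; rewrite -scalemxAr !gaZ -scalemxAr; congr (_ *: _).
have := ga_conj cgv k; rewrite !tnth_map => ->.
by rewrite (ga_conj cv) scalemxAr.
Qed.

Lemma dual_orbit w v : w_dual t Omega w v ->
  dual_flags t Omega w = [set act g (flag_of v) | g in K Omega].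
Proof.
apply: orbit_flags => [u [] //|g [] //|g u|g u]; [exact: K_dual|exact: dual_K].
Qed.

Lemma conj_orbit w v : w_conjugate t Omega w v ->
  conjugate_flags t Omega w = [set act g (flag_of v) | g in G0 Omega].
Proof.
apply: orbit_flags => [u [] //|g [] //|g u|g u];
  [exact: G0_conj|exact: conj_G0].
Qed.

Lemma dual_conj_orbit w v : w_dual t Omega w v -> w_conjugate t Omega w v ->
  [set flag_of u | u in w_dual t Omega w `&` w_conjugate t Omega w] =
  [set act g (flag_of v) | g in K Omega `&` G0 Omega].
Proof.
move=> dv cv; apply: orbit_flags => // [u [[] //]|g [[] //]|g u|].
  move=> [Kg Gg] [du cu].
  by split; [exact: K_dual|exact: G0_conj].
by move=> g u gU [du cu] [dgu cgu]; split;
  [exact: dual_K dgu|exact: conj_G0 cgu].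
Qed.

Hypothesis compO : compatible t Omega.

Lemma dual_flagsE w : involutions t w -> dual_flags t Omega w =
  [set F | X F /\ relpos (w0_after w) (orth_chain Omega F, F)].
Proof.
move=> iw; have [ww _] := iw; apply/seteqP; split=> [_ [v dv <-]|F [XF rF]].
  by split; [apply: X_flag_of; case: dv|exact: (relpos_dual ww dv)].
have [w' [v [[ww' _] dv vF]]] := exists_dual compO XF.
have := relpos_dual ww' dv; rewrite vF => /(relpos_inj rF) /mulIg ->.
by exists v.
Qed.

Lemma conj_flagsE w : involutions t w -> conjugate_flags t Omega w =
  [set F | X F /\ relpos w (gamma_chain Omega F, F)].
Proof.
move=> iw; have [ww _] := iw; apply/seteqP; split=> [_ [v cv <-]|F [XF rF]].
  by split; [apply: X_flag_of; case: cv|exact: (relpos_conj compO ww cv)].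
have [w' [v [[ww' _] cv vF]]] := exists_conj compO XF.
have := relpos_conj compO ww' cv; rewrite vF => /(relpos_inj rF) ->.
by exists v.
Qed.

Lemma dual_conj_flags w : involutions t w ->
  dual_flags t Omega w `&` conjugate_flags t Omega w =
  [set flag_of v | v in w_dual t Omega w `&` w_conjugate t Omega w].
Proof.
move=> iw; apply/seteqP; split=> [_ [[v dv <-] [v' cv vv']]|_ [v [dv cv] <-]].
  have [u [du cu uv]] := dual_conj_basis compO iw dv cv vv'.
  by exists u.
by split; exists v.
Qed.

Lemma dual_flags_inj w w' : involutions t w -> involutions t w' ->
  dual_flags t Omega w = dual_flags t Omega w' -> w = w'.
Proof.
move=> iw iw' e; have [v [dv _]] := exists_dual_conj compO iw.
have : dual_flags t Omega w (flag_of v) by exists v.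
move=> /[dup]; rewrite {1}e !dual_flagsE // => -[_ r'] [_ r].
by apply: (@mulIg _ (w0 n)); exact: relpos_inj r r'.
Qed.

Lemma conj_flags_inj w w' : involutions t w -> involutions t w' ->
  conjugate_flags t Omega w = conjugate_flags t Omega w' -> w = w'.
Proof.
move=> iw iw' e; have [v [_ cv]] := exists_dual_conj compO iw.
have : conjugate_flags t Omega w (flag_of v) by exists v.
by move=> /[dup]; rewrite {1}e !conj_flagsE // => -[_ r'] [_ /relpos_inj];
  exact.
Qed.

Lemma K_orbits :
  [set dual_flags t Omega w | w in involutions t] = orbits (K Omega).
Proof.
apply/seteqP; split=> [_ [w iw <-]|_ [F XF <-]].
  have [v [dv _]] := exists_dual_conj compO iw.
  by exists (flag_of v); [apply: X_flag_of; case: dv|rewrite (dual_orbit dv)].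
have [w [v [iw dv <-]]] := exists_dual compO XF.
by exists w => //; exact: dual_orbit.
Qed.

Lemma G0_orbits :
  [set conjugate_flags t Omega w | w in involutions t] = orbits (G0 Omega).
Proof.
apply/seteqP; split=> [_ [w iw <-]|_ [F XF <-]].
  have [v [_ cv]] := exists_dual_conj compO iw.
  by exists (flag_of v); [apply: X_flag_of; case: cv|rewrite (conj_orbit cv)].
have [w [v [iw cv <-]]] := exists_conj compO XF.
by exists w => //; exact: conj_orbit.
Qed.

Lemma perm_rank_le_of_meet w w' : involutions t w -> involutions t w' ->
  dual_flags t Omega w `&` conjugate_flags t Omega w' !=set0 ->
  forall k l : 'I_n.+1, (perm_rank w' k l <= perm_rank w k l)%N.
Proof.
move=> [ww _] [ww' _] [_ [[v dv <-] [v' cv vv']]] k l.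
exact: (perm_rank_conj_le_dual compO ww ww' dv cv vv').
Qed.

Definition duality (O : set (chain R n)) : set (chain R n) :=
  [set F | exists w, [/\ involutions t w, O = dual_flags t Omega w
                       & conjugate_flags t Omega w F]].

Lemma dualityE w : involutions t w ->
  duality (dual_flags t Omega w) = conjugate_flags t Omega w.
Proof.
move=> iw; apply/seteqP; split=> [F|F cF]; last by exists w.
by move=> [w' [iw' /(dual_flags_inj iw iw') ->]].
Qed.

Lemma duality_pairing : matsuki_pairing Omega duality.
Proof.
split; last first.
  move=> O; rewrite -K_orbits => -[w iw <-];
    rewrite dualityE // dual_conj_flags //.
  have [v [dv cv]] := exists_dual_conj compO iw; exists (flag_of v).
    by apply: X_flag_of; case: dv.
  by rewrite (dual_conj_orbit dv cv).
rewrite -K_orbits -G0_orbits; split.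
- by move=> _ [w iw <-]; rewrite dualityE //; exists w.
- move=> O O'; rewrite !inE => -[w iw <-] [w' iw' <-]; rewrite !dualityE //.
  by move=> /conj_flags_inj ->.
- by move=> _ [w iw <-]; exists (dual_flags t Omega w);
  [exists w|exact: dualityE].
Qed.

(** [s] is the permutation of involutions induced by the second pairing. It is
    extended by the identity to all permutations so that the finite iteration
    [iter_order] applies. *)
Lemma duality_unique Xi : matsuki_pairing Omega Xi ->
  forall w, involutions t w ->
    Xi (dual_flags t Omega w) = conjugate_flags t Omega w.
Proof.
move=> [[Xif Xii _] XiO].
have KO w : involutions t w -> orbits (K Omega) (dual_flags t Omega w).
  by move=> iw; rewrite -K_orbits; exists w.
have /choice[s sP] w : exists w', (involutions t w -> involutions t w' /\
    Xi (dual_flags t Omega w) = conjugate_flags t Omega w') /\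
    (~ involutions t w -> w' = w).
  have [iw|niw] := pselect (involutions t w); last by exists w.
  have : orbits (G0 Omega) (Xi (dual_flags t Omega w)) by apply/Xif/KO.
  by rewrite -G0_orbits => -[w' iw' <-]; exists w'.
have s_inj : injective s.
{ move=> w w' e; have [iw iw'] := (sP w, sP w').
  have [|niw] := pselect (involutions t w);
    have [|niw'] := pselect (involutions t w').
  - move=> jw' jw; have [_ E] := iw.1 jw; have [_ E'] := iw'.1 jw'.
    apply: dual_flags_inj => //; apply: Xii; rewrite ?inE; [exact: KO..|].
    by rewrite E E' e.
  - by move=> jw; case: (niw'); rewrite -(iw'.2 niw') -e; case: (iw.1 jw).
  - by move=> jw'; case: (niw); rewrite -(iw.2 niw) e; case: (iw'.1 jw').
  - by rewrite -(iw.2 niw) -(iw'.2 niw'). }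
have s_le w (k l : 'I_n.+1) : (perm_rank (s w) k l <= perm_rank w k l)%N.
  have [iw|niw] := pselect (involutions t w); last by rewrite (sP w).2.
  have [isw E] := (sP w).1 iw; apply: perm_rank_le_of_meet => //.
  have [F XF FE] := XiO _ (KO _ iw); rewrite -E -FE.
  exists (act 1%:M F); exists 1%:M => //; split; split;
    rewrite /GL /= ?unitmx1 //.
    by move=> x y; rewrite !mul1mx.
  by move=> x; rewrite !mul1mx.
have s_iter w m (k l : 'I_n.+1) :
    (perm_rank (iter m s w) k l <= perm_rank w k l)%N.
  by elim: m => //= m; exact: leq_trans (s_le _ _ _).
have sw w : s w = w.
  apply: perm_rank_inj => k l; apply/eqP; rewrite eqn_leq s_le /=.
  rewrite -{1}(iter_order s_inj w) -orderSpred iterSr.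
  exact: s_iter.
by move=> w iw; have [] := (sP w).1 iw; rewrite sw.
Qed.

Lemma duality_matsuki : matsuki_duality Omega duality.
Proof.
split; first exact: duality_pairing.
move=> Xi XiP O; rewrite -K_orbits => -[w iw <-].
by rewrite dualityE // (duality_unique XiP).
Qed.
End Orbits.

Theorem proposition4 (R : realType) (t : typeA) (n : nat) (Omega : 'M[R[i]]_n)
    (Omega_std : standard_form t Omega) :
  (* (a) *)
  (forall w : 'S_n, involutions t w ->
     [/\ dual_flags t Omega w !=set0,
         conjugate_flags t Omega w !=set0,
         dual_flags t Omega w `&` conjugate_flags t Omega w =
           [set flag_of v | v in w_dual t Omega w `&` w_conjugate t Omega w] &
         dual_flags t Omega w `&` conjugate_flags t Omega w !=set0]) /\
  (* (b) *)
  (forall w : 'S_n, involutions t w ->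
     dual_flags t Omega w =
       [set F | X F /\ relpos (w0_after w) (orth_chain Omega F, F)] /\
     conjugate_flags t Omega w =
       [set F | X F /\ relpos w (gamma_chain Omega F, F)]) /\
  (* (c) *)
  ([set dual_flags t Omega w | w in involutions t] = orbits (K Omega) /\
   [set conjugate_flags t Omega w | w in involutions t] = orbits (G0 Omega)) /\
  (* (d) *)
  (exists Xi : set (chain R n) -> set (chain R n),
     matsuki_duality Omega Xi /\
     forall w : 'S_n, involutions t w ->
       Xi (dual_flags t Omega w) = conjugate_flags t Omega w).
Proof.
have compO := standard_compatible Omega_std.
split=> [w iw|]; last split=> [w iw|]; last split.
- have [v [dv cv]] := exists_dual_conj compO iw.
  have dw : dual_flags t Omega w (flag_of v) by exists v.
  have cw : conjugate_flags t Omega w (flag_of v) by exists v.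
  split; [by exists (flag_of v)|by exists (flag_of v)|exact: dual_conj_flags|].
  by exists (flag_of v).
- by split; [exact: dual_flagsE|exact: conj_flagsE].
- by split; [exact: K_orbits|exact: G0_orbits].
- by exists (duality t Omega); split; [exact: duality_matsuki|exact: dualityE].
Qed.
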